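(* Let $X$ be a Banach space satisfying the daggers, i.e. satisfying both of the following: ($\dagger$) $X^*$ has a monotone weak$^*$-FDD $(X^*_m)$; and ($\ddagger$) for every constant $C$ with $0<C<1$ there is a constant $C'$ such that for all $x^*\in X^*$ and all $j\in\mathbb N$, $$\|(I-P_j)x^*\|\le C\|x^*\|+C'\bigl(\|x^*\|-\|P_jx^*\|\bigr),$$ where $(P_j)$ is the sequence of FDD projections, so $P_j(X^* )=[X^*_m:m\le j]$. Then $C([1,\omega^\omega])$ is not isomorphic to a quotient of $C([1,\omega]\times\beta\mathbb N,X)$.
   Context: For a compact Hausdorff space $K$ and a Banach space $X$, $C(K,X)$ is the Banach space of continuous functions $f:K\to X$ with norm $\|f\|=\sup_{k\in K}\|f(k)\|_X$; $C(K)=C(K,\mathbb R)$. $\beta\mathbb N$ is the Stone–Čech compactification of the discrete space $\mathbb N$. For an ordinal $\alpha$, $[1,\alpha]$ is the compact space of ordinals between $1$ and $\alpha$ in the order topology; powers are ordinal powers. $[\,\cdot\,]$ applied to a family of subspaces denotes its closed linear span. A weak$^*$-FDD (weak$^*$ finite dimensional decomposition) of $X^*$ is a sequence $(X^*_m)$ of finite dimensional subspaces of $X^*$ such that every $x^*\in X^*$ has a unique expansion $x^*=\sum_m x^*_m$ with $x^*_m\in X^*_m$, the series converging in the weak$^*$ topology, and such that the FDD projections $P_j(\sum_m x_m^* )=\sum_{m\le j}x_m^*$ are bounded and weak$^*$-continuous. It is monotone if $\|P_j\|\le 1$ for all $j$. *)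

(* Defs.v *)
From HB Require Import structures.
From mathcomp Require Import all_boot all_order all_algebra finmap.
From mathcomp Require Import generic_quotient ring_quotient.
From mathcomp Require Import all_classical all_reals all_analysis.

Set Implicit Arguments.
Unset Strict Implicit.
Unset Printing Implicit Defensive.

Import Order.TTheory GRing.Theory Num.Theory.
Import numFieldNormedType.Exports.

Local Open Scope classical_set_scope.
Local Open Scope ring_scope.

HB.mixin Record isCompactHausdorff T & Topological T := {
  compT : compact [set: T];
  hausT : hausdorff_space T
}.

#[short(type="compHausType")]
HB.structure Definition CompactHausdorff :=
  {T of Topological T & isCompactHausdorff T}.

Section prod_compHaus.
Context (K L : compHausType).

Let prod_compact : compact [set: K * L].
Proof.
by rewrite -setXTT; apply: compact_setX; exact: compT.
Qed.

Let prod_hausdorff : hausdorff_space (K * L)%type.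
Proof.
move=> [a b] [c d] cl; congr pair; apply: hausT => A B nA nB.
- have [||[x y] [/= Ax Bx]] := cl (A `*` setT) (B `*` setT).
  + by exists (A, setT) => //; split => //; exact: filterT.
  + by exists (B, setT) => //; split => //; exact: filterT.
  by exists x; split; [case: Ax|case: Bx].
- have [||[x y] [/= Ay By]] := cl (setT `*` A) (setT `*` B).
  + by exists (setT, A) => //; split => //; exact: filterT.
  + by exists (setT, B) => //; split => //; exact: filterT.
  by exists y; split; [case: Ay|case: By].
Qed.

HB.instance Definition _ :=
  isCompactHausdorff.Build (K * L)%type prod_compact prod_hausdorff.
End prod_compHaus.

HB.mixin Record isWellOrder d T & Order.BTotal d T := {
  well_orderP : forall S : set T, S !=set0 ->
    exists2 x, S x & forall y, S y -> (x <= y)%O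
}.

#[short(type="wellOrderType")]
HB.structure Definition WellOrder d := {T of Order.BTotal d T & isWellOrder d T}.

Fact nat_well_order (S : set nat) : S !=set0 ->
  exists2 x, S x & forall y, S y -> (x <= y)%O.
Proof.
move=> [n Sn]; have exS : exists n, `[< S n >] by exists n; apply/asboolP.
exists (ex_minn exS); case: ex_minnP => m /asboolP Sm mmin // y Sy.
by rewrite leEnat; apply/mmin/asboolP.
Qed.

HB.instance Definition _ := isWellOrder.Build _ nat nat_well_order.

(** For a non-empty well-order [A] of type alpha, [upto A] is the set of
    ordinals <= alpha: an element of [A] stands for the type of the initial
    segment strictly below it, and [None] stands for alpha itself. *)
Definition upto (A : Type) := option A.

Section upto_order.
Context {d : Order.disp_t} {A : wellOrderType d}.
Implicit Types x y z : upto A.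

HB.instance Definition _ := Choice.on (upto A).

Definition upto_le x y : bool :=
  match x, y with
  | _, None => true
  | None, Some _ => false
  | Some a, Some b => (a <= b)%O
  end.

Let upto_le_refl : reflexive upto_le.
Proof. by case=> //= a; exact: lexx. Qed.

Let upto_le_anti : antisymmetric upto_le.
Proof. by move=> [a|] [b|] //= /le_anti ->. Qed.

Let upto_le_trans : transitive upto_le.
Proof. by move=> [a|] [b|] [c|] //=; exact: le_trans. Qed.

Let upto_le_total : total upto_le.
Proof. by move=> [a|] [b|] //=; exact: le_total. Qed.

Fact upto_display : Order.disp_t. Proof. exact: Order.Disp tt tt. Qed.

HB.instance Definition _ := Order.Le_isPOrder.Build upto_display (upto A)
  upto_le_refl upto_le_anti upto_le_trans.
HB.instance Definition _ :=
  Order.POrder_isTotal.Build upto_display (upto A) upto_le_total.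

End upto_order.

Fact interval1_display : Order.disp_t. Proof. exact: Order.Disp tt tt. Qed.

Section interval1.
Context {d : Order.disp_t} (A : wellOrderType d).

(** The ordinals between 1 and alpha, i.e. all those <= alpha but the least
    one, 0. *)
Definition interval1_ord : Type := {x : upto A | x != Some \bot%O}.
HB.instance Definition _ := SubChoice.on interval1_ord.
HB.instance Definition _ :=
  [SubChoice_isSubOrder of interval1_ord by <: with interval1_display].

Definition interval1 : Type := order_topology interval1_ord.
HB.instance Definition _ := OrderTopological.on interval1.

Let top : interval1 := exist _ (None : upto A) isT.

Let le_top (x : interval1) : (x <= top)%O.
Proof. by case: x => -[a|]. Qed.

Let interval1_wo (S : set interval1) : S !=set0 ->
  exists2 x, S x & forall y, S y -> (x <= y)%O.
Proof.
move=> [x0 Sx0].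
have [[a [ha Sa]]|noS] := pselect
    (exists a : A, exists ha : Some a != Some \bot%O :> upto A, S (exist _ (Some a) ha)).
  pose S' := [set a : A | exists ha : Some a != Some \bot%O :> upto A,
     S (exist _ (Some a) ha)].
  have [|b [hb Sb] bmin] := @well_orderP _ A S'; first by exists a, ha.
  exists (exist _ (Some b) hb) => // -[[c|] hc] Sc //.
  by apply: bmin; exists hc.
exists x0 => // -[[c|] hc] Sc; last exact: le_top.
by exfalso; apply: noS; exists c, hc.
Qed.

Let interval1_compact : compact [set: interval1].
Proof.
rewrite compact_ultra => F UF _.
have [|x Fx xmin] := @interval1_wo [set x | F [set y | (y <= x)%O]].
  by exists top => /=; apply: filterS filterT => y _; exact: le_top.
exists x; split => // U; rewrite nbhs_simpl /= itv_nbhsE => -[i [oi xi]].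
suff Fi : F [set` i] by move=> /filterS; exact.
have Fr z : (x < z)%O -> F [set y | (y < z)%O].
  by move=> xz; apply: filterS Fx => y /= /le_lt_trans; exact.
have Fl z : (z < x)%O -> F [set y | (z < y)%O].
  move=> zx; have [Fz|] := in_ultra_setVsetC [set y | (y <= z)%O] UF.
    by move: (xmin _ Fz); rewrite leNgt zx.
  by apply: filterS => y /= /negP; rewrite -ltNge.
case: i oi xi => [[[] l|[]] [[] r|[]]]//=; rewrite ?in_itv /=.
- move=> _ /andP[lx xr]; apply: filterS (filterI (Fl _ lx) (Fr _ xr)).
  by move=> y [/= ly yr]; rewrite in_itv/= ly yr.
- rewrite andbT => _ lx; apply: filterS (Fl _ lx).
  by move=> y /= ly; rewrite in_itv/= ly.
- by move=> _ xr; apply: filterS (Fr _ xr) => y /= yr; rewrite in_itv.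
- by move=> _ _; apply: filterS filterT => y _ /=; rewrite in_itv.
Qed.

HB.instance Definition _ := isCompactHausdorff.Build interval1
  interval1_compact (@order_hausdorff _ interval1).
End interval1.

(** The ordinal power omega ^ omega: finitely supported functions from omega to
    omega compared at the largest index where they differ; [f] stands for the
    ordinal with Cantor normal form ... + omega^2 * f 2 + omega * f 1 + f 0. *)
Definition omega_omega : Type := {fsfun nat -> nat with 0%N}.
HB.instance Definition _ := Choice.on omega_omega.

Section omega_omega_order.
Implicit Types f g h : omega_omega.

Definition oo_lt f g : bool :=
  `[< exists2 n, (f n < g n)%N & forall m, (n < m)%N -> f m = g m >].
Definition oo_le f g : bool := (f == g) || oo_lt f g.

Lemma oo_bound f : exists N, forall n, (N <= n)%N -> f n = 0%N.
Proof.
exists (\max_(i <- finsupp f) i).+1 => n Nn.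
apply/eqP/negPn/negP => fn0.
have nf : n \in finsupp f by rewrite mem_finsupp.
by move: Nn; rewrite ltnNge (@leq_bigmax_seq _ (enum_fset (finsupp f)) xpredT id n nf).
Qed.

Lemma oo_lt_total f g : f != g -> oo_lt f g || oo_lt g f.
Proof.
move=> fg; have [Nf Hf] := oo_bound f; have [Ng Hg] := oo_bound g.
have exP : exists n, f n != g n.
  apply: contrapT => /forallNP fgn; move/negP: fg; apply; apply/eqP/fsfunP => n.
  by apply/eqP/negPn/negP/fgn.
have bP n : f n != g n -> (n <= maxn Nf Ng)%N.
  apply: contraR; rewrite -ltnNge gtn_max => /andP[/ltnW fn /ltnW gn].
  by rewrite Hf // Hg.
case: (ex_maxnP exP bP) => n fgn nmax.
have fgm m : (n < m)%N -> f m = g m.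
  by move=> nm; apply/eqP; apply: contraLR nm => /nmax; rewrite -leqNgt.
by move: fgn; rewrite neq_ltn => /orP[] h; apply/orP; [left|right];
  apply/asboolP; exists n => // m /fgm.
Qed.

Lemma oo_lt_irr f : oo_lt f f = false.
Proof. by apply/asboolP => -[n]; rewrite ltnn. Qed.

Lemma oo_lt_trans : transitive oo_lt.
Proof.
move=> g f h /asboolP[n fgn fg] /asboolP[m ghm gh]; apply/asboolP.
have [nm|mn|nm] := ltngtP n m.
- exists m; first by rewrite fg.
  by move=> k mk; rewrite fg ?gh // (ltn_trans nm).
- exists n; first by rewrite -gh.
  by move=> k nk; rewrite fg ?gh // (ltn_trans mn).
- subst m; exists n; first exact: ltn_trans ghm.
  by move=> k nk; rewrite fg ?gh.
Qed.

Fact omega_omega_display : Order.disp_t. Proof. exact: Order.Disp tt tt. Qed.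

Let oo_lt_def f g : oo_lt f g = (g != f) && oo_le f g.
Proof.
rewrite /oo_le eq_sym; have [->|] := eqVneq f g => //=.
by rewrite oo_lt_irr.
Qed.

Let oo_le_refl : reflexive oo_le. Proof. by move=> f; rewrite /oo_le eqxx. Qed.

Let oo_le_anti : antisymmetric oo_le.
Proof.
move=> f g; rewrite /oo_le => /andP[/orP[/eqP//|fg] /orP[/eqP->//|gf]].
by have := oo_lt_trans fg gf; rewrite oo_lt_irr.
Qed.

Let oo_le_trans : transitive oo_le.
Proof.
move=> g f h; rewrite /oo_le => /orP[/eqP->//|fg] /orP[/eqP<-|gh].
  by rewrite fg orbT.
by rewrite (oo_lt_trans fg gh) orbT.
Qed.

Let oo_le_total : total oo_le.
Proof.
move=> f g; rewrite /oo_le; have [->|fg] := eqVneq f g; first by [].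
exact: oo_lt_total.
Qed.

HB.instance Definition _ := Order.isPOrder.Build omega_omega_display omega_omega
  oo_lt_def oo_le_refl oo_le_anti oo_le_trans.
HB.instance Definition _ :=
  Order.POrder_isTotal.Build omega_omega_display omega_omega oo_le_total.

Let oo0 : omega_omega := [fsfun].

Let oo0_le f : (oo0 <= f)%O.
Proof.
rewrite /Order.le /= /oo_le; have [//|nf] := eqVneq oo0 f.
have /orP[//|/asboolP[n]] := oo_lt_total nf.
by rewrite fsfun0E ltn0.
Qed.

HB.instance Definition _ :=
  Order.hasBottom.Build omega_omega_display omega_omega oo0_le.

Let oo_wo_agree n (S : set omega_omega) : S !=set0 ->
  (forall f g, S f -> S g -> forall m, (n <= m)%N -> f m = g m) ->
  exists2 f, S f & forall g, S g -> (f <= g)%O.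
Proof.
elim: n S => [|n IH] S S0 agree.
  have [f Sf] := S0; exists f => // g Sg.
  suff -> : f = g by exact: lexx.
  by apply/fsfunP => m; exact: agree.
have [|a [f0 Sf0 f0a] amin] := @nat_well_order [set f n | f in S].
  by have [f Sf] := S0; exists (f n), f.
have [|f g [Sf fa] [Sg ga] m|f [Sf fa] fmin] := IH (S `&` [set f | f n = a]).
- by exists f0.
- rewrite leq_eqVlt => /orP[/eqP<-|nm]; last exact: agree.
  by rewrite fa ga.
exists f => // g Sg; have [ga|ga] := eqVneq (g n) a; first exact: fmin.
apply: ltW; apply/asboolP; exists n; last by move=> m nm; exact: agree.
by rewrite fa ltn_neqAle eq_sym ga -leEnat; apply: amin; exists g.
Qed.

Let oo_well_order (S : set omega_omega) : S !=set0 ->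
  exists2 f, S f & forall g, S g -> (f <= g)%O.
Proof.
move=> [f0 Sf0]; have [N f0N] := oo_bound f0.
have [||f [Sf fN] fmin] :=
    @oo_wo_agree N (S `&` [set f | forall n, (N <= n)%N -> f n = 0%N]).
- by exists f0.
- by move=> f g [_ fN] [_ gN] m Nm; rewrite fN ?gN.
exists f => // g Sg.
have [gN|gN] := pselect (forall n, (N <= n)%N -> g n = 0%N); first exact: fmin.
rewrite leNgt; apply/negP => /asboolP[n gfn gf].
apply: gN => m Nm; rewrite gf ?fN //.
rewrite (leq_trans _ Nm) // ltnNge; apply/negP => Nn.
by move: gfn; rewrite fN.
Qed.

HB.instance Definition _ :=
  isWellOrder.Build omega_omega_display omega_omega oo_well_order.
End omega_omega_order.

(** The Stone-Cech compactification of the discrete space [N], realized as the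
    space of ultrafilters on [N]; the sets [beta_open A] form a base. *)
Definition beta (N : Type) : Type := {F : set_system N | UltraFilter F}.

Section beta_topology.
Context (N : Type).

HB.instance Definition _ := gen_eqMixin (beta N).
HB.instance Definition _ := gen_choiceMixin (beta N).

Definition beta_open (A : set N) : set (beta N) := [set F | sval F A].

Let beta_ultra (F : beta N) : UltraFilter (sval F) := svalP F.

Let beta_cover : \bigcup_(A in [set: set N]) beta_open A = setT.
Proof.
apply/seteqP; split => // F _; exists setT => //.
by have := beta_ultra F => UF; exact: filterT.
Qed.

Let beta_join (A B : set N) (F : beta N) : [set: set N] A -> [set: set N] B ->
  beta_open A F -> beta_open B F ->
  exists C, [/\ [set: set N] C, beta_open C F &
    beta_open C `<=` beta_open A `&` beta_open B].
Proof.
move=> _ _ FA FB; exists (A `&` B); split => //.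
  by have := beta_ultra F => UF; exact: filterI.
move=> G GAB; have := beta_ultra G => UG.
by split; apply: filterS GAB => x [].
Qed.

HB.instance Definition _ :=
  isBaseTopological.Build (beta N) beta_cover beta_join.

Lemma nbhs_beta (F : beta N) (U : set (beta N)) :
  nbhs F U <-> exists2 A, sval F A & beta_open A `<=` U.
Proof.
rewrite nbhsE; split=> [[V [[D _ <-] [A DA FA]] VU]|[A FA AU]].
  by exists A => // G GA; apply: VU; exists A.
exists (beta_open A) => //; split => //.
by exists [set A]; [move=> _ ->|rewrite bigcup_set1].
Qed.

Let beta_compact : compact [set: beta N].
Proof.
rewrite compact_ultra => G UG _.
pose F := [set A : set N | G (beta_open A)].
have FF : Filter F.
  split.
  - rewrite /F /=; apply: filterS filterT => H _.
    by have := beta_ultra H => UH; exact: filterT.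
  - rewrite /F /= => A B FA FB; apply: filterS (@filterI _ G _ _ _ FA FB) => H [HA HB].
    by have := beta_ultra H => UH; exact: filterI.
  - rewrite /F /= => A B AB; apply: filterS => H HA.
    by have := beta_ultra H => UH; exact: filterS HA.
have PF : ProperFilter F.
  apply: Build_ProperFilter_ex => A FA; have [H HA] := @filter_ex _ G _ _ FA.
  by have := beta_ultra H => UH; exact: filter_ex HA.
have UF : UltraFilter F.
  split=> // H HF FH; apply/seteqP; split=> // A HA.
  have [//|GA] := in_ultra_setVsetC (beta_open A) UG.
  have /FH HnA : F (~` A).
    apply: filterS GA => J nJA.
    by have [/nJA|] := in_ultra_setVsetC A (beta_ultra J).
  by have [x []] := @filter_ex _ H _ _ (@filterI _ H _ _ _ HA HnA).
exists (exist _ F UF); split => // U /nbhs_beta[A FA AU].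
exact: (@filterS _ G _ _ _ AU FA).
Qed.

Let beta_hausdorff : hausdorff_space (beta N).
Proof.
move=> F G cFG; suff FG : sval F = sval G.
  by case: F G FG {cFG} => F uF [G uG] /= FG; exact: eq_exist.
apply: (@max_filter _ _ (beta_ultra G)).
  by case: (beta_ultra F).
move=> A GA; have [//|FnA] := in_ultra_setVsetC A (beta_ultra F).
have [||H [HnA HA]] := cFG (beta_open (~` A)) (beta_open A).
- by apply/nbhs_beta; exists (~` A).
- by apply/nbhs_beta; exists A.
have := beta_ultra H => UH.
by have [x []] := @filter_ex _ (sval H) _ _ (@filterI _ (sval H) _ _ _ HnA HA).
Qed.

HB.instance Definition _ :=
  isCompactHausdorff.Build (beta N) beta_compact beta_hausdorff.

End beta_topology.

Section continuous_maps.
Context (R : realType) (K : compHausType) (X : normedModType R).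

Definition cont_pred : {pred K -> X} := fun f => `[< continuous f >].

Let cont_submod : submod_closed cont_pred.
Proof.
split; first by apply/asboolP => k; exact: cvg_cst.
move=> a f g /asboolP cf /asboolP cg; apply/asboolP => k.
by apply: cvgD; [apply: cvgZ; [exact: cvg_cst|exact: cf]|exact: cg].
Qed.

HB.instance Definition _ := GRing.isSubmodClosed.Build R (K -> X) cont_pred
  cont_submod.

Definition cont_space : Type := {f : K -> X | f \in cont_pred}.
HB.instance Definition _ := SubChoice.on cont_space.
HB.instance Definition _ := [SubChoice_isSubLmodule of cont_space by <:].

Definition cont_fun (f : cont_space) : K -> X := val f.

Definition cont_norm (f : cont_space) : R :=
  sup [set `|cont_fun f k| | k in [set: K]].

Let cont_ub (f : cont_space) : has_ubound [set `|cont_fun f k| | k in [set: K]].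
Proof.
have cf : continuous (cont_fun f) by exact/asboolP/(valP f).
have /compact_bounded[M [_ /(_ (M + 1)) HM]] : compact (cont_fun f @` setT).
  apply: continuous_compact; last exact: compT.
  exact: continuous_subspaceT.
exists (M + 1) => _ [k _ <-]; apply: HM; first by rewrite ltrDl.
by exists k.
Qed.

Let cont_norm_ge (f : cont_space) k : `|cont_fun f k| <= cont_norm f.
Proof. by apply: ub_le_sup; [exact: cont_ub|exists k]. Qed.

Let cont_norm_ge0 (f : cont_space) : 0 <= cont_norm f.
Proof.
have [[k _]|K0] := pselect ([set: K] !=set0).
  exact: le_trans (normr_ge0 _) (cont_norm_ge f k).
rewrite /cont_norm (_ : [set _ | _ in _] = set0) ?sup0 //.
by apply/seteqP; split => // x [k _ _]; apply: K0; exists k.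
Qed.

Let cont_norm_le (f : cont_space) (M : R) : 0 <= M ->
  (forall k, `|cont_fun f k| <= M) -> cont_norm f <= M.
Proof.
move=> M0 fM; have [[k _]|K0] := pselect ([set: K] !=set0).
  by apply: ge_sup; [exists `|cont_fun f k|, k|move=> _ [l _ <-]].
rewrite /cont_norm (_ : [set _ | _ in _] = set0) ?sup0 //.
by apply/seteqP; split => // x [k _ _]; apply: K0; exists k.
Qed.

Let cont_normD (f g : cont_space) : cont_norm (f + g) <= cont_norm f + cont_norm g.
Proof.
apply: cont_norm_le => [|k]; first by rewrite addr_ge0.
exact: le_trans (ler_normD _ _) (lerD _ _).
Qed.

Let cont_normZ (a : R) (f : cont_space) : cont_norm (a *: f) = `|a| * cont_norm f.
Proof.
have le_normZ b g : cont_norm (b *: g) <= `|b| * cont_norm g.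
  apply: cont_norm_le => [|k]; first by rewrite mulr_ge0.
  by rewrite /cont_fun /= normrZ ler_wpM2l// cont_norm_ge.
apply/le_anti/andP; split; first exact: le_normZ.
have [->|a0] := eqVneq a 0; first by rewrite normr0 mul0r.
rewrite -ler_pdivlMl ?normr_gt0// -normfV.
by apply: le_trans (le_normZ _ _); rewrite scalerA mulVf// scale1r.
Qed.

Let cont_norm0 (f : cont_space) : cont_norm f = 0 -> f = 0.
Proof.
move=> f0; apply/val_inj/funext => k; apply/eqP.
by rewrite -normr_le0 -f0; exact: cont_norm_ge.
Qed.

HB.instance Definition _ :=
  Lmodule_isNormed.Build R cont_space cont_normD cont_normZ cont_norm0.

End continuous_maps.
Arguments cont_space {R} K X.

(** For an unbounded [T] the supremum takes the default value 0, so [opnorm] is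
    only used together with boundedness. *)
Definition opnorm {R : realType} {V W : normedModType R} (T : V -> W) : R :=
  sup [set `|T v| | v in [set v | `|v| <= 1]].

Definition bounded_op {R : realType} {V W : normedModType R} (T : V -> W) :=
  exists M : R, forall v, `|T v| <= M * `|v|.

Section dual.
Context (R : realType) (X : normedModType R).

Definition dual_pred : {pred X -> R} :=
  fun f => `[< linear f /\ continuous f >].

Let dual_submod : submod_closed dual_pred.
Proof.
split.
  apply/asboolP; split; last by move=> x; exact: cvg_cst.
  by move=> a x y; rewrite scaler0 addr0.
move=> a f g /asboolP[lf cf] /asboolP[lg cg]; apply/asboolP; split.
  by move=> b x y; rewrite !fctE lf lg !scalerDr !scalerA (mulrC b) addrACA.
move=> x.
by apply: cvgD; [apply: cvgZ; [exact: cvg_cst|exact: cf]|exact: cg].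
Qed.

HB.instance Definition _ := GRing.isSubmodClosed.Build R (X -> R) dual_pred
  dual_submod.

Definition dual : Type := {f : X -> R | f \in dual_pred}.
HB.instance Definition _ := SubChoice.on dual.
HB.instance Definition _ := [SubChoice_isSubLmodule of dual by <:].

Definition dual_fun (f : dual) : X -> R := val f.

Definition dual_norm (f : dual) : R := opnorm (dual_fun f).

Let dual_ub (f : dual) :
  has_ubound [set `|dual_fun f x| | x in [set x | `|x| <= 1]].
Proof.
have [lf cf] : linear (dual_fun f) /\ continuous (dual_fun f).
  exact/asboolP/(valP f).
pose fl : {linear X -> R} := HB.pack (dual_fun f)
  (GRing.isLinear.Build _ _ _ _ (dual_fun f) lf).
have : bounded_near fl (nbhs (0 : X)).
  by apply: (@continuous_linear_bounded _ _ _ 0 fl); exact: cf.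
move=> /linear_boundedP[M [_ HM]]; exists (`|M| + 1) => _ [x x1 <-].
have HM1 := HM (`|M| + 1).
apply: le_trans (HM1 _ x) _; first by rewrite ltr_pwDr// ler_norm.
by rewrite ler_piMr// addr_ge0.
Qed.

Let dual_norm_ge (f : dual) x : `|x| <= 1 -> `|dual_fun f x| <= dual_norm f.
Proof. by move=> x1; apply: ub_le_sup; [exact: dual_ub|exists x]. Qed.

Let dual_norm_ge0 (f : dual) : 0 <= dual_norm f.
Proof. by apply: le_trans (normr_ge0 _) (dual_norm_ge f (_ : `|0| <= 1)); rewrite normr0. Qed.

Let dual_norm_le (f : dual) (M : R) :
  (forall x, `|x| <= 1 -> `|dual_fun f x| <= M) -> dual_norm f <= M.
Proof.
move=> fM; apply: ge_sup; last by move=> _ [x x1 <-]; exact: fM.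
by exists `|dual_fun f 0|, 0 => //=; rewrite normr0.
Qed.

Let dual_normD (f g : dual) : dual_norm (f + g) <= dual_norm f + dual_norm g.
Proof.
apply: dual_norm_le => x x1.
by apply: le_trans (ler_normD _ _) (lerD _ _); exact: dual_norm_ge.
Qed.

Let dual_normZ (a : R) (f : dual) : dual_norm (a *: f) = `|a| * dual_norm f.
Proof.
have le_normZ b g : dual_norm (b *: g) <= `|b| * dual_norm g.
  apply: dual_norm_le => x x1.
  by rewrite /dual_fun /= normrZ ler_wpM2l// dual_norm_ge.
apply/le_anti/andP; split; first exact: le_normZ.
have [->|a0] := eqVneq a 0; first by rewrite normr0 mul0r.
rewrite -ler_pdivlMl ?normr_gt0// -normfV.
by apply: le_trans (le_normZ _ _); rewrite scalerA mulVf// scale1r.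
Qed.

Let dual_norm0 (f : dual) : dual_norm f = 0 -> f = 0.
Proof.
move=> f0; have [lf _] : linear (dual_fun f) /\ continuous (dual_fun f).
  exact/asboolP/(valP f).
pose fl : {linear X -> R} := HB.pack (dual_fun f)
  (GRing.isLinear.Build _ _ _ _ (dual_fun f) lf).
apply/val_inj/funext => x; change (fl x = 0).
have [->|x0] := eqVneq x 0; first exact: linear0.
have := @dual_norm_ge f (`|x|^-1 *: x); rewrite f0 normrZ normfV normr_id.
rewrite mulVf ?normr_eq0// lexx => /(_ isT).
rewrite -[dual_fun f]/(fl : X -> R) linearZ normr_le0 scaler_eq0.
by rewrite invr_eq0 normr_eq0 (negbTE x0) => /eqP.
Qed.

HB.instance Definition _ :=
  Lmodule_isNormed.Build R dual dual_normD dual_normZ dual_norm0.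

Definition weak_star : Type := dual.
HB.instance Definition _ := Topological.copy weak_star
  (initial_topology (dual_fun : dual -> {ptws X -> R})).

Lemma weak_star_cvgP (u : nat -> dual) (f : dual) :
  ((u : nat -> weak_star) @ \oo --> (f : weak_star)) <->
  forall x, dual_fun (u n) x @[n --> \oo] --> dual_fun f x.
Proof.
have P := @pointwise_cvgP X R ((fun n => dual_fun (u n)) @ \oo) (dual_fun f) _.
split=> H.
  apply/P.
  have h := @initial_continuous dual {ptws X -> R} dual_fun f.
  by move=> U nU; exact: (H _ (h _ nU)).
move=> U [_ [[A oA <-] /= Af] AU].
have /P : forall x, dual_fun (u n) x @[n --> \oo] --> dual_fun f x by exact: H.
move=> /(_ A) [|N _ HN]; first exact: open_nbhs_nbhs.
by exists N => // n /HN; exact: AU.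
Qed.

End dual.

Record closedSubspace (R : realType) (V : normedModType R) := ClosedSubspace {
  subspace_pred :> {pred V};
  subspace_submod : submod_closed subspace_pred;
  subspace_closed : closed [set v | v \in subspace_pred]
}.

HB.instance Definition _ (R : realType) (V : normedModType R)
    (M : closedSubspace V) :=
  GRing.isSubmodClosed.Build R V (subspace_pred M) (subspace_submod M).

Section quotient.
Context (R : realType) (V : normedModType R) (M : closedSubspace V).
Local Open Scope quotient_scope.

Definition quotient_space : Type := Quotient.quot (subspace_pred M : zmodClosed V).
Local Notation Q := quotient_space.
HB.instance Definition _ := GRing.Zmodule.on Q.
HB.instance Definition _ := ZmodQuotient.on Q.

Definition quotient_scale (a : R) (q : Q) : Q := \pi_Q (a *: repr q).

Lemma quotient_piE (v w : V) : \pi_Q v = \pi_Q w <-> v - w \in M.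
Proof.
change (\pi_Q v = \pi_Q w <-> (v - w \in (subspace_pred M : zmodClosed V))).
by rewrite Quotient.idealrBE; split=> /eqP.
Qed.

Lemma quotient_pi_scale a v : quotient_scale a (\pi_Q v) = \pi_Q (a *: v).
Proof.
apply/quotient_piE; rewrite -scalerBr rpredZ//.
by apply/quotient_piE; rewrite reprK.
Qed.

Let quotient_ex (q : Q) : exists v, q = \pi_Q v.
Proof. by exists (repr q); rewrite reprK. Qed.

Let piD (v w : V) : \pi_Q (v + w) = \pi_Q v + \pi_Q w.
Proof. exact: (raddfD \pi_Q). Qed.

Let scaleA a b (q : Q) :
  quotient_scale a (quotient_scale b q) = quotient_scale (a * b) q.
Proof.
have [v ->] := quotient_ex q.
by rewrite (quotient_pi_scale b) (quotient_pi_scale a) quotient_pi_scale scalerA.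
Qed.

Let scale1 : left_id 1 quotient_scale.
Proof.
by move=> q; have [v ->] := quotient_ex q; rewrite quotient_pi_scale scale1r.
Qed.

Let scaleDr : right_distributive quotient_scale +%R.
Proof.
move=> a p q; have [v ->] := quotient_ex p; have [w ->] := quotient_ex q.
rewrite -piD (quotient_pi_scale a (v + w)) (quotient_pi_scale a v).
by rewrite (quotient_pi_scale a w) scalerDr piD.
Qed.

Let scaleDl (q : Q) : {morph quotient_scale^~ q : a b / a + b}.
Proof.
move=> a b /=; have [v ->] := quotient_ex q.
rewrite (quotient_pi_scale (a + b)) (quotient_pi_scale a) (quotient_pi_scale b).
by rewrite scalerDl piD.
Qed.

HB.instance Definition _ :=
  GRing.Zmodule_isLmodule.Build R Q scaleA scale1 scaleDr scaleDl.

Definition quotient_norm (q : Q) : R := inf [set `|v| | v in [set v | \pi_Q v = q]].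

Let Q_lb (q : Q) : has_lbound [set `|v| | v in [set v | \pi_Q v = q]].
Proof. by exists 0 => _ [v _ <-]. Qed.

Let Q_norm_le (v : V) : quotient_norm (\pi_Q v) <= `|v|.
Proof. by apply: ge_inf => //; exists v. Qed.

Let Q_norm_ge (q : Q) (c : R) :
  (forall v, \pi_Q v = q -> c <= `|v|) -> c <= quotient_norm q.
Proof.
move=> cq; apply: lb_le_inf; last by move=> _ [v vq <-]; exact: cq.
by exists `|repr q|, (repr q) => //=; rewrite reprK.
Qed.

Let Q_normD (p q : Q) : quotient_norm (p + q) <= quotient_norm p + quotient_norm q.
Proof.
rewrite -lerBlDr; apply: Q_norm_ge => v vp.
rewrite lerBlDr -lerBlDl; apply: Q_norm_ge => w wq; rewrite lerBlDl.
by rewrite -vp -wq -piD; apply: le_trans (Q_norm_le _) (ler_normD _ _).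
Qed.

Let Q_normZ (a : R) (q : Q) : quotient_norm (a *: q) = `|a| * quotient_norm q.
Proof.
have Q0 p : 0 <= quotient_norm p by apply: Q_norm_ge => v _.
have [->|a0] := eqVneq a 0.
  apply/le_anti; rewrite normr0 mul0r Q0 andbT scale0r -(raddf0 \pi_Q).
  by apply: le_trans (Q_norm_le _) _; rewrite normr0.
have le_normZ b p : b != 0 -> quotient_norm (b *: p) <= `|b| * quotient_norm p.
  move=> b0; rewrite -ler_pdivrMl ?normr_gt0//; apply: Q_norm_ge => v <-.
  rewrite ler_pdivrMl ?normr_gt0// -normrZ -[b *: _]/(quotient_scale b _).
  by rewrite quotient_pi_scale; exact: Q_norm_le.
apply/le_anti/andP; split; first exact: le_normZ.
rewrite -ler_pdivlMl ?normr_gt0// -normfV.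
by apply: le_trans (le_normZ _ _ _); rewrite ?invr_eq0// scalerA mulVf// scale1r.
Qed.

Let Q_norm0 (q : Q) : quotient_norm q = 0 -> q = 0.
Proof.
move=> q0; rewrite -[q]reprK -(raddf0 \pi_Q); apply/quotient_piE; rewrite subr0.
apply: (@subspace_closed _ _ M (repr q)).
move=> U /nbhs_ballP[e /= e0 eU].
have [_ [v vq <-] ve] : exists2 x, [set `|v| | v in [set v | \pi_Q v = q]] x & x < 0 + e.
  rewrite -q0; apply: inf_adherent => //; split => //.
  by exists `|repr q|, (repr q) => //=; rewrite reprK.
exists (repr q - v); split.
  by apply/quotient_piE; rewrite reprK.
by apply: eU; rewrite -ball_normE /= opprB addrC subrK; rewrite add0r in ve.
Qed.

HB.instance Definition _ := Lmodule_isNormed.Build R Q Q_normD Q_normZ Q_norm0.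

End quotient.

Definition isomorphic {R : realType} (V W : normedModType R) : Prop :=
  exists (T : V -> W) (S : W -> V),
    [/\ linear T, continuous T, continuous S, cancel T S & cancel S T].

Definition finite_dimensional {R : realType} {V : lmodType R} (E : set V) :=
  exists (n : nat) (b : 'I_n -> V),
    E = [set \sum_(i < n) c i *: b i | c in [set: 'I_n -> R]].

Section FDD.
Context {R : realType} {X : normedModType R}.
Implicit Types (E : nat -> set (dual X)) (f : dual X).

Definition wstar_expansion E f (u : nat -> dual X) : Prop :=
  (forall m, E m (u m)) /\
  ((series u : nat -> weak_star X) @ \oo --> (f : weak_star X)).

(** The pieces are numbered from 0. [FDD_proj E j] is only meaningful when every
    functional has a unique expansion; [xget] then picks it. *)
Definition FDD_proj E (j : nat) f : dual X :=
  \sum_(m < j.+1) xget (fun=> 0) [set u | wstar_expansion E f u] m.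

Definition wstar_FDD E : Prop :=
  [/\ forall m, finite_dimensional (E m),
      forall f, exists! u, wstar_expansion E f u,
      forall j, bounded_op (FDD_proj E j)
    & forall j, continuous (FDD_proj E j : weak_star X -> weak_star X)].

Definition monotone_FDD E : Prop := forall j, opnorm (FDD_proj E j) <= 1.

Definition double_dagger E : Prop :=
  forall C : R, 0 < C < 1 -> exists C' : R, forall f j,
    `|f - FDD_proj E j f| <= C * `|f| + C' * (`|f| - `|FDD_proj E j f|).

End FDD.

Definition satisfies_daggers {R : realType} (X : normedModType R) : Prop :=
  exists E : nat -> set (dual X),
    [/\ wstar_FDD E, monotone_FDD E & double_dagger E].

(* Main.v *)
(** Let [T] map C([1, omega] x beta N, X) onto C([1, omega^omega]), and for an
    ordinal [a] let [phi_a f = T f a].  Functionals on C([1, omega] x beta N, X)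
    are finitely additive [X^*]-valued measures of bounded variation; measure
    [phi] by its total mass plus its mass on the ordinals [< omega].  Suppose
    [a_n] increases to [a]; the [phi_(a_n)] then converge weak-* to [phi_a], and
    since [T] is onto they are uniformly equivalent to the basis of l^1.  We
    claim that the mass of some [phi_(a_n)] exceeds the mass of [phi_a] by a
    constant.
    - Either a fixed part of the mass of the [phi_(a_n)] escapes to [omega]
      through the ordinals [< omega]; in the limit it leaves [1, omega[.
    - Or the [phi_(a_n)] can be pushed forward to a finite sum of copies of
      [beta N].  After the projection [P_j] they are finite dimensional, and by
      Grothendieck's theorem (setwise convergent sequences of measures converge
      weakly) signed sums of differences become small relative to the number of
      summands; so the part [(I - P_j) phi_(a_n)] is large, and the
      double-dagger inequality turns it into a gain of total mass.
    Climbing down from [omega^k] through points of Cantor-Bendixson rank k, k-1,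
    ..., 0 gains [k] times the constant, while the masses are bounded. *)
From HB Require Import structures.
Require Import Defs.
From mathcomp Require Import all_boot all_order all_algebra finmap.
From mathcomp Require Import generic_quotient ring_quotient.
From mathcomp Require Import all_classical all_reals all_analysis.
From mathcomp Require Import ring lra zify.

Set Implicit Arguments.
Unset Strict Implicit.
Unset Printing Implicit Defensive.

Import Order.TTheory GRing.Theory Num.Theory.
Import numFieldNormedType.Exports.

Local Open Scope classical_set_scope.
Local Open Scope ring_scope.

(** * Finitely additive set functions *)

(** Flipping the [i]-th sign is an involution of the sign vectors; for [i != k] it negates every
    product, so the sum equals its own opposite. *)
Lemma sum_sign_mul (R : realDomainType) (m : nat) (i k : 'I_m) :
  \sum_(e : {ffun 'I_m -> bool}) ((-1) ^+ e i * (-1) ^+ e k) =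
  if i == k then #|{: {ffun 'I_m -> bool}}|%:R else 0 :> R.
Proof.
have [->|ik] := eqVneq i k.
  rewrite (eq_bigr (fun=> 1)) ?sumr_const// => e _.
  by rewrite -expr2 sqrr_sign.
set S := LHS; pose flip (e : {ffun 'I_m -> bool}) := [ffun l => e l (+) (l == i)].
have flipK : involutive flip.
  by move=> e; apply/ffunP => l; rewrite !ffunE -addbA addbb addbF.
suff : S = - S by move/eqP; rewrite -addr_eq0 -mulr2n mulrn_eq0 /= => /eqP.
rewrite {1}/S (reindex_inj (inv_inj flipK)) /= /S -sumrN; apply: eq_bigr => e _.
by rewrite !ffunE eqxx eq_sym (negbTE ik) addbF signr_addb/= expr1 mulrN1 mulNr.
Qed.

Lemma sum_sign_square (R : realDomainType) (m : nat) (g : 'I_m -> R) :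
  \sum_(e : {ffun 'I_m -> bool}) (\sum_i (-1) ^+ e i * g i) ^+ 2 =
  #|{: {ffun 'I_m -> bool}}|%:R * \sum_i g i ^+ 2.
Proof.
under eq_bigr do rewrite expr2 big_distrlr.
rewrite exchange_big mulr_sumr; apply: eq_bigr => i _ /=.
rewrite exchange_big (bigD1 i) //= [X in _ + X]big1 ?addr0 => [|k ki].
  under eq_bigr do rewrite mulrACA.
  by rewrite -mulr_suml sum_sign_mul eqxx expr2.
under eq_bigr do rewrite mulrACA.
by rewrite -mulr_suml sum_sign_mul eq_sym (negbTE ki) mul0r.
Qed.

(** With S the sum of the [|g i|], the second moment bounds the average of the signed sums by sqrt(M
    S). AM-GM replaces 2 l sqrt(M S) by M + l^2 S, which is linear in M and S and can be summed over
    points. *)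
Lemma sum_sign_max (R : realFieldType) (m : nat) (g : 'I_m -> R) (M l : R) :
  0 < l -> 0 <= M -> (forall i, `|g i| <= M) ->
  2 * l * \sum_(e : {ffun 'I_m -> bool}) `|\sum_i (-1) ^+ e i * g i| <=
  #|{: {ffun 'I_m -> bool}}|%:R * (M + l ^+ 2 * \sum_i `|g i|).
Proof.
move=> l0 M0 gM.
have amgm (x s : R) : s * (2 * l * x) <= x ^+ 2 + (l * s) ^+ 2.
  by have := sqr_ge0 (x - l * s); lra.
set S := \sum_i `|g i|; set N := #|_|%:R.
have S0 : 0 <= S by apply: sumr_ge0.
have [S00|Sn0] := eqVneq S 0.
  rewrite big1 ?mulr0 => [|e _].
    by rewrite mulr_ge0// addr_ge0// mulr_ge0// sqr_ge0.
  apply/eqP; rewrite normr_eq0 big1// => i _; apply/eqP.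
  rewrite mulf_eq0 signr_eq0 /= -normr_eq0.
  by move/eqP: S00; rewrite psumr_eq0// => /allP/(_ i (mem_index_enum _)).
have {Sn0}S0 : 0 < S by rewrite lt_neqAle eq_sym Sn0.
have SE : \sum_i g i ^+ 2 <= M * S.
  rewrite mulr_sumr; apply: ler_sum => i _.
  by rewrite -real_normK ?num_real// expr2 ler_wpM2r.
move: S SE S0 => S SE S0; rewrite -(ler_pM2l S0).
have -> : S * (N * (M + l ^+ 2 * S)) = N * (M * S) + N * (l * S) ^+ 2 by ring.
apply: (@le_trans _ _ (\sum_(e : {ffun 'I_m -> bool})
   ((\sum_i (-1) ^+ e i * g i) ^+ 2 + (l * S) ^+ 2))).
  rewrite !mulr_sumr; apply: ler_sum => e _.
  rewrite -[X in _ <= X + _]real_normK ?num_real//.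
rewrite big_split /= sum_sign_square sumr_const -[_ *+ #|_|]mulr_natl lerD2r.
by rewrite ler_wpM2l.
Qed.

(* Averaging over the signs, E|sum e_i g_i| <= sqrt(max |g_i| * sum |g_i|), so
   functions whose signed sums all have large L^1 norm have a large maximum. *)
Lemma signed_sums_max (R : realFieldType) (C : finType) (m : nat)
    (g : 'I_m -> C -> R) (B c : R) : (0 < m)%N -> 0 < B -> 0 < c ->
  (forall i, \sum_a `|g i a| <= B) ->
  (forall e : {ffun 'I_m -> bool},
     c * m%:R <= \sum_a `|\sum_i (-1) ^+ e i * g i a|) ->
  exists k : C -> 'I_m, c ^+ 2 / B * m%:R <= \sum_a `|g (k a) a|.
Proof.
case: m g => // m g _ B0 c0 gB gc.
pose k a := [arg max_(i > ord0) `|g i a|]%O.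
have kmax a i : `|g i a| <= `|g (k a) a|.
  by rewrite /k; case: arg_maxP => // j _; exact.
(* This value maximizes 2 l c - l^2 B; the maximum is c^2 / B. *)
exists k; pose l := c / B; have l0 : 0 < l by rewrite divr_gt0.
set N := #|{: {ffun 'I_m.+1 -> bool}}|%:R : R.
have N0 : 0 < N.
  by rewrite ltr0n; apply/card_gt0P; exists [ffun=> true].
have H1 : 2 * l * (N * (c * m.+1%:R)) <=
    2 * l * \sum_a \sum_(e : {ffun 'I_m.+1 -> bool}) `|\sum_i (-1) ^+ e i * g i a|.
  rewrite ler_pM2l ?mulr_gt0 ?invr_gt0// exchange_big /= /N mulr_natl -sumr_const.
  by apply: ler_sum => e _.
have H2 : 2 * l * \sum_a \sum_(e : {ffun 'I_m.+1 -> bool}) `|\sum_i (-1) ^+ e i * g i a|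
   <= N * (\sum_a `|g (k a) a| + l ^+ 2 * (B * m.+1%:R)).
  apply: (@le_trans _ _ (N * (\sum_a `|g (k a) a| + l ^+ 2 * \sum_a \sum_i `|g i a|))).
    rewrite [in leRHS]mulr_sumr -big_split !mulr_sumr /=.
    apply: ler_sum => a _; exact: sum_sign_max.
  rewrite ler_wpM2l ?(ltW N0)// lerD2l ler_wpM2l ?sqr_ge0// exchange_big /=.
  by rewrite mulr_natr -[m.+1 in leRHS]card_ord -sumr_const; apply: ler_sum => i _.
have := le_trans H1 H2.
have -> : 2 * l * (N * (c * m.+1%:R)) = N * (2 * l * c * m.+1%:R) by ring.
rewrite (ler_pM2l N0) -lerBlDr; apply: le_trans.
by rewrite le_eqVlt; apply/orP; left; apply/eqP; rewrite /l; field; rewrite gt_eqF.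
Qed.

Definition fin_additive (T : Type) (V : zmodType) (nu : set T -> V) :=
  forall A B, A `&` B = set0 -> nu (A `|` B) = nu A + nu B.

Section fin_additive.
Context (T : Type) (V : zmodType) (nu : set T -> V).
Hypothesis nuD : fin_additive nu.

Lemma fin_additive0 : nu set0 = 0.
Proof.
have := nuD (@set0I _ (@set0 T)); rewrite setU0 => /eqP.
by rewrite -subr_eq0 opprD addNKr oppr_eq0 => /eqP.
Qed.

Lemma fin_additiveID A B : nu A = nu (A `&` B) + nu (A `\` B).
Proof.
rewrite -nuD ?setUIDK//.
by apply/seteqP; split => // x [[_ Bx] [_ /(_ Bx)]].
Qed.

Lemma fin_additive_restr W : fin_additive (fun A => nu (A `&` W)).
Proof.
by move=> A B AB; rewrite setIUl nuD// setIACA AB set0I.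
Qed.

Lemma fin_additive_fiber (I : finType) (c : T -> I) (P : pred I) :
  nu [set t | P (c t)] = \sum_(i | P i) nu [set t | c t = i].
Proof.
have H (s : seq I) : uniq s ->
    nu [set t | c t \in s] = \sum_(i <- s) nu [set t | c t = i].
  elim: s => [_|i s IH /= /andP[si us]].
    by rewrite big_nil (_ : [set _ | _] = set0) ?fin_additive0// -subset0 => x.
  rewrite big_cons -IH// -nuD.
    congr nu; apply/seteqP; split => x /=; rewrite inE.
      by move=> /orP[/eqP|]; [left|right].
    by move=> [->|->]; rewrite ?eqxx ?orbT.
  by apply/seteqP; split => // x /= [-> si']; move: si; rewrite si'.
rewrite -big_enum -H ?enum_uniq//; congr nu.
by apply/seteqP; split => x /=; rewrite mem_enum.
Qed.

End fin_additive.

Lemma fin_additive_split (T : Type) (V : zmodType) (nu : set T -> V)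
    (I : finType) (c : T -> I) A : fin_additive nu ->
  nu A = \sum_i nu ([set t | c t = i] `&` A).
Proof.
move=> nuD; rewrite -(fin_additive_fiber (fin_additive_restr nuD A) c xpredT).
by congr nu; apply/seteqP; split => [x|x []].
Qed.

Lemma fin_additive_sum (T : Type) (R : pzRingType) (V : lmodType R) (I : finType)
    (a : I -> R) (nu : I -> set T -> V) : (forall i, fin_additive (nu i)) ->
  fin_additive (fun A => \sum_i a i *: nu i A).
Proof.
move=> nuD A B AB; rewrite -big_split; apply: eq_bigr => i _ /=.
by rewrite nuD// scalerDr.
Qed.

(** Bounds the total variation of [nu] on [A], the supremum of these differences over [S], without
    forming the supremum. *)
Definition tv_le (R : numDomainType) (T : Type) (nu : set T -> R) (A : set T) (b : R) :=
  forall S, nu (A `&` S) - nu (A `\` S) <= b.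

Section total_variation.
Context (R : realDomainType) (T : Type) (nu : set T -> R).
Hypothesis nuD : fin_additive nu.

(** A splitting of [B] extends to [A] by putting all of A minus B on the side where its contribution
    is nonnegative. *)
Lemma tv_le_sub A B b : B `<=` A -> tv_le nu A b -> tv_le nu B b.
Proof.
move=> BA nuA S; have [h|/ltW h] := lerP 0 (nu (A `\` B)).
- apply: le_trans (nuA ((B `&` S) `|` (A `\` B))).
  have -> : A `&` ((B `&` S) `|` (A `\` B)) = (B `&` S) `|` (A `\` B).
    by apply/setIidPr => x [[/BA]|[]].
  have -> : A `\` ((B `&` S) `|` (A `\` B)) = B `\` S.
    apply/seteqP; split => x [Ax h']; split; [|..].
    - by apply: contrapT => Bx; apply: h'; right.
    - move=> Sx; apply: h'; have [Bx|Bx] := pselect (B x); first by left.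
      by right.
    - exact: BA.
    - by move=> [[_ /h']|[_ /(_ Ax)]].
  rewrite nuD ?lerD2r ?lerDl//.
  by apply/seteqP; split => // x [[Bx _] [_ /(_ Bx)]].
- apply: le_trans (nuA (B `&` S)).
  have -> : A `&` (B `&` S) = B `&` S by apply/setIidPr => x [/BA].
  rewrite lerD2l lerN2 (fin_additiveID nuD (A `\` (B `&` S)) B).
  have -> : (A `\` (B `&` S)) `&` B = B `\` S.
    apply/seteqP; split => x.
      by move=> [[Ax h'] Bx]; split => // Sx; apply: h'.
    by move=> [Bx Sx]; split => //; split; [exact: BA|move=> [_ /Sx]].
  have -> : (A `\` (B `&` S)) `\` B = A `\` B.
    apply/seteqP; split => x; first by move=> [[Ax _] Bx].
    by move=> [Ax Bx]; split => //; split => // -[/Bx].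
  by rewrite gerDl.
Qed.

Lemma tv_le_norm A B b : B `<=` A -> tv_le nu A b -> `|nu B| <= b.
Proof.
move=> BA /(tv_le_sub BA) nuB.
have := nuB setT; have := nuB set0.
rewrite setI0 setD0 setIT setDT (fin_additive0 nuD) subr0 sub0r.
by rewrite ler_norml lerNl => -> ->.
Qed.

Lemma tv_leU A B a b : tv_le nu A a -> tv_le nu B b -> tv_le nu (A `|` B) (a + b).
Proof.
move=> nuA nuB S; have {}nuB := tv_le_sub (@subDsetl _ B A) nuB.
have -> : (A `|` B) `&` S = (A `&` S) `|` ((B `\` A) `&` S).
  by rewrite -setIUl setUDr setDv setD0.
have -> : (A `|` B) `\` S = (A `\` S) `|` ((B `\` A) `\` S).
  by rewrite -setDUl setUDr setDv setD0.
rewrite !nuD.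
- by have := lerD (nuA S) (nuB S); lra.
- by apply/seteqP; split => // x [[Ax _] [[_ /(_ Ax)]]].
- by apply/seteqP; split => // x [[Ax _] [[_ /(_ Ax)]]].
Qed.

Lemma tv_le_ex A : exists S, 0 <= nu (A `&` S) - nu (A `\` S).
Proof.
have [h|/ltW h] := lerP 0 (nu A).
  by exists setT; rewrite setIT setDT (fin_additive0 nuD) subr0.
by exists set0; rewrite setI0 setD0 (fin_additive0 nuD) sub0r oppr_ge0.
Qed.

(** Pigeonhole: splittings of value above [h] on every fibre over [D] would glue to one splitting of
    the whole space of value above [h * #|D|]. *)
Lemma tv_le_fiber (I : finType) (c : T -> I) (D : {set I}) B h :
  tv_le nu setT B -> D != finset.set0 -> B <= h * #|D|%:R ->
  exists2 i, i \in D & tv_le nu [set t | c t = i] h.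
Proof.
move=> nuB D0 Bh; apply: contrapT => H.
have /choice[S HS] : forall i, exists S, (if i \in D then h else 0) <
    nu ([set t | c t = i] `&` S) - nu ([set t | c t = i] `\` S) ?<= if (i \notin D).
  move=> i; case: ifPn => iD; last by exact: tv_le_ex.
  apply: contrapT => HS; apply: H; exists i => // S; rewrite leNgt; apply/negP => hS.
  by apply: HS; exists S.
pose S' := [set t | S (c t) t].
have := nuB S'; rewrite setTI setTD.
rewrite (fin_additive_split c S' nuD) (fin_additive_split c (~` S') nuD) -sumrB.
apply/negP; rewrite -ltNge; apply: le_lt_trans Bh _.
have -> : h * #|D|%:R = \sum_i if i \in D then h else 0.
  by rewrite -big_mkcond/= sumr_const mulr_natr.
have SE i : [set t | c t = i] `&` S' = [set t | c t = i] `&` S i.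
  by apply/seteqP; split => t /= [<-].
have SE' i : [set t | c t = i] `&` ~` S' = [set t | c t = i] `\` S i.
  by apply/seteqP; split => t /= [<-].
have /set0Pn[i0 i0D] := D0.
rewrite (bigD1 i0)//= [ltRHS](bigD1 i0)//=; apply: ltr_leD.
  by have := HS i0; rewrite i0D /= SE SE'.
by apply: ler_sum => i _; have := HS i; rewrite SE SE'; apply: lteifW.
Qed.
End total_variation.

Section fibers.
Context (R : realDomainType) (T : Type) (nu : set T -> R) (I : finType) (c : T -> I).
Hypothesis nuD : fin_additive nu.

Lemma fiber_sum_ge (P : pred I) :
  nu [set t | P (c t)] - nu (~` [set t | P (c t)]) <= \sum_i `|nu [set t | c t = i]|.
Proof.
have -> : ~` [set t | P (c t)] = [set t | predC P (c t)].
  by apply/seteqP; split => t /= /negP.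
rewrite !(fin_additive_fiber nuD) [leRHS](bigID P) /= -sumrN.
by apply: lerD; apply: ler_sum => i _; rewrite ?ler_norm// -normrN ler_norm.
Qed.

Lemma fiber_sum_norm (P : pred I) : \sum_(i | P i) `|nu [set t | c t = i]| =
  nu [set t | P (c t) && (0 <= nu [set t' | c t' = c t])] -
  nu [set t | P (c t) && ~~ (0 <= nu [set t' | c t' = c t])].
Proof.
have h1 := fin_additive_fiber nuD c (fun i => P i && (0 <= nu [set t | c t = i])).
have h2 := fin_additive_fiber nuD c (fun i => P i && ~~ (0 <= nu [set t | c t = i])).
rewrite /= in h1 h2; rewrite h1 h2.
rewrite (bigID (fun i => 0 <= nu [set t | c t = i])) /= -sumrN; congr (_ + _).
  by apply: eq_bigr => i /andP[_ /ger0_norm].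
by apply: eq_bigr => i /andP[_]; rewrite -ltNge => /ltr0_norm.
Qed.

Lemma fiber_sum_le B : tv_le nu setT B -> \sum_i `|nu [set t | c t = i]| <= B.
Proof.
move=> nuB; rewrite fiber_sum_norm /=.
set S := [set t | 0 <= nu [set t' | c t' = c t]].
have := nuB S; rewrite setTI setTD.
by congr (_ - nu _ <= _); apply/seteqP; split => t /negP.
Qed.
End fibers.

Lemma infinite_pigeonhole (I : finType) (P : nat -> I -> Prop) :
  (forall j, exists i, P j i) -> exists i, forall n, exists2 j, (n < j)%N & P j i.
Proof.
move=> H; apply: contrapT => /forallNP nP.
have /choice[f fP] : forall i, exists n, forall j, (n < j)%N -> ~ P j i.
  by move=> i; have /existsNP[n Hn] := nP i; exists n => j nj Pj; apply: Hn; exists j.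
have [i] := H (\max_i f i).+1.
by apply: fP; rewrite ltnS; exact: leq_bigmax.
Qed.

Lemma extract (P : nat -> Prop) n0 : (forall n, exists2 j, (n < j)%N & P j) ->
  exists r : nat -> nat,
    [/\ {homo r : i j / (i < j)%N}, forall i, P (r i) & forall i, (n0 < r i)%N].
Proof.
move=> H; have /choice[f fP] : forall n, exists j, (n < j)%N /\ P j.
  by move=> n; have [j] := H n; exists j.
have rS : {homo (fun i => iter i.+1 f n0) : i j / (i < j)%N}.
  by apply: homo_ltn => [|i]; [exact: ltn_trans|have [] := fP (iter i.+1 f n0)].
exists (fun i => iter i.+1 f n0); split => // [i|i]; first by have [] := fP (iter i f n0).
by elim: i => [|i IH] /=; [have [] := fP n0|exact: (ltn_trans IH (fP _).1)].
Qed.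

(** * Extraction of a block on which later charges are small *)

Section step.
Context (R : realType) (T : Type) (sg : nat -> set T -> R) (B c : R).
Hypotheses (B0 : 0 < B) (c0 : 0 < c) (sgD : forall n, fin_additive (sg n)).
Hypothesis sgB : forall n, tv_le (sg n) setT B.
Hypothesis sgc : forall m (e : {ffun 'I_m -> bool}), exists S,
  c * m%:R <= \sum_i (-1) ^+ e i * (sg i S - sg i (~` S)).

(** [signed_sums_max] cuts the space into [m] classes such that many [sg i] have a fixed mass on
    their own class. For large [m] each [sg j] has small variation on one of these classes, and some
    class serves infinitely many [j]. *)
Lemma split_step h : 0 < h -> exists i A, c ^+ 2 / (4 * B) <= `|sg i A| /\
  forall n, exists2 j, (n < j)%N & tv_le (sg j) A h.
Proof.
move=> h0; pose q := c ^+ 2 / (2 * B).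
have q0 : 0 < q by apply: divr_gt0; rewrite ?exprn_gt0 ?mulr_gt0.
(* At least [q / B * m] classes will carry mass; [h] times that number must reach [B] for the
   pigeonhole argument. *)
pose m := (Num.truncn (B ^+ 2 / (q * h))).+1.
have mh : B <= h * (q / B * m%:R).
  have : B ^+ 2 / (q * h) < m%:R by rewrite /m truncnS_gt.
  rewrite ltr_pdivrMr; last exact: mulr_gt0.
  move=> /ltW; rewrite expr2 -ler_pdivlMr//.
  by move/le_trans; apply; rewrite le_eqVlt; apply/orP; left; apply/eqP; ring.
have /choice[S HS] := @sgc m.
(* The colours are the atoms of the algebra generated by the sets [S e]. *)
pose col t : {ffun {ffun 'I_m -> bool} -> bool} := [ffun e => `[< S e t >]].
pose g (i : 'I_m) a := sg i [set t | col t = a].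
have gB i : \sum_a `|g i a| <= B by exact: fiber_sum_le.
have gc (e : {ffun 'I_m -> bool}) : c * m%:R <= \sum_a `|\sum_i (-1) ^+ e i * g i a|.
  apply: le_trans (HS e) _.
  have D : fin_additive (fun A => \sum_(i < m) (-1) ^+ e i * sg i A).
    by apply: (@fin_additive_sum _ _ R^o) => i; exact: sgD.
  have := fiber_sum_ge col D (fun a => a e).
  have -> : [set t | col t e] = S e by apply/seteqP; split => t /=; rewrite ffunE => /asboolP.
  by rewrite -sumrB; under eq_bigr do rewrite -mulrBr.
have [//|k kP] := signed_sums_max _ B0 c0 gB gc.
(* Indices with mass at least [q], half of the guaranteed average, on the colours assigned to
   them. *)
pose D := [set i : 'I_m | q <= \sum_(a | k a == i) `|g i a|]%SET.
have DB : q * m%:R <= B * #|D|%:R.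
  have : \sum_a `|g (k a) a| = \sum_i \sum_(a | k a == i) `|g i a|.
    rewrite (partition_big k xpredT)//=; apply: eq_bigr => i _.
    by apply: eq_bigr => a /eqP ->.
  have : \sum_i \sum_(a | k a == i) `|g i a| <= B * #|D|%:R + q * m%:R.
    rewrite (bigID (mem D)) /=; apply: lerD.
      rewrite mulr_natr -sumr_const; apply: ler_sum => i _.
      by apply: le_trans (gB i); rewrite [leRHS](bigID (fun a => k a == i)) lerDl sumr_ge0.
    apply: (@le_trans _ _ (\sum_(i < m | i \notin D) q)).
      by apply: ler_sum => i; rewrite inE -ltNge => /ltW.
    rewrite big_mkcond /= mulr_natr -[X in _ *+ X]card_ord -sumr_const.
    by apply: ler_sum => i _; case: ifP => // _; exact: ltW.
  move=> h1 h2; rewrite -h2 in h1; have := le_trans kP h1.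
  rewrite -lerBlDr; apply: le_trans.
  rewrite le_eqVlt; apply/orP; left; apply/eqP; rewrite /q; field.
  by rewrite gt_eqF.
have D0 : D != finset.set0.
  rewrite -card_gt0 -(ltr0n R) -(pmulr_rgt0 _ B0); apply: lt_le_trans DB.
  by rewrite mulr_gt0// ltr0n.
have hD : B <= h * #|D|%:R.
  apply: le_trans mh _; rewrite ler_pM2l//.
  by rewrite mulrAC ler_pdivrMr// [leRHS]mulrC.
have [i Hi] : exists i, forall n, exists2 j, (n < j)%N &
    i \in D /\ tv_le (sg j) [set t | k (col t) = i] h.
  apply: infinite_pigeonhole => j.
  by have [i iD Hi] := tv_le_fiber (sgD j) (k \o col) (sgB j) D0 hD; exists i.
have [_ _ [iD _]] := Hi 0%N.
have HA A : A `<=` [set t | k (col t) = i] -> c ^+ 2 / (4 * B) <= `|sg i A| ->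
  exists i A, c ^+ 2 / (4 * B) <= `|sg i A| /\
  forall n, exists2 j, (n < j)%N & tv_le (sg j) A h.
  move=> Ai A1; exists i, A; split=> // n; have [j nj [_ Hj]] := Hi n.
  by exists j => //; exact: tv_le_sub Hj.
(* The mass [q] is the charge of the positive colours minus that of the negative ones; one of the
   two parts carries at least half of it. *)
move: iD; rewrite inE /g (fiber_sum_norm col (sgD i)).
set A1 := [set t | _ && _]; set A2 := [set t | _ && _] => qA.
have q2 : q = c ^+ 2 / (4 * B) + c ^+ 2 / (4 * B) by rewrite /q; field; rewrite gt_eqF.
have [h1|h1] := lerP (c ^+ 2 / (4 * B)) `|sg i A1|.
  by apply: HA h1 => t /andP[/eqP].
apply: (HA A2) => [t /andP[/eqP]//|].
have := ler_norm (sg i A1); have := ler_norm (- sg i A2); rewrite normrN; lra.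
Qed.
End step.

(** * Setwise null sequences are not l^1 sequences *)

Lemma homo_ltn_comp (s r : nat -> nat) : {homo s : i j / (i < j)%N} ->
  {homo r : i j / (i < j)%N} -> {homo s \o r : i j / (i < j)%N}.
Proof. by move=> sS rS i j ij; apply/sS/rS. Qed.

Lemma homo_ltn_ge (s : nat -> nat) n : {homo s : i j / (i < j)%N} -> (n <= s n)%N.
Proof.
by move=> sS; elim: n => // n IH; apply: leq_ltn_trans IH _; exact: sS.
Qed.

Lemma homo_ltn_inj (s : nat -> nat) : {homo s : i j / (i < j)%N} -> injective s.
Proof. by move=> sS; apply: incn_inj; apply: leq_mono. Qed.

(* Drewnowski's thinning argument: on a sparse set of indices the mass that each
   [rho k] puts on the other indices is small, so the union of those indices
   witnesses that [rho k] does not tend to 0. *)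
Lemma phillips (R : realType) (rho : nat -> set nat -> R) (B d : R) :
  0 < d -> (forall k, fin_additive (rho k)) -> (forall k, tv_le (rho k) setT B) ->
  (forall M, rho k M @[k --> \oo] --> 0) ->
  exists k, `|rho k [set k]| < d.
Proof.
move=> d0 rD rB r0; apply: contrapT => /forallNP Hd.
have {}Hd k : d <= `|rho k [set k]| by rewrite leNgt; apply/negP/Hd.
have d4 : 0 < d / 4 by rewrite divr_gt0.
(* State of the thinning: [x.1] enumerates the indices still available, [x.2] is the set of indices
   already selected. *)
pose inv (x : (nat -> nat) * set nat) :=
  {homo x.1 : i j / (i < j)%N} /\ forall j, `|rho (x.1 j) x.2| <= d / 4.
pose St := {x | inv x}.
pose next (x y : St) := [/\ range (sval y).1 `<=` range (sval x).1,
  ((sval x).1 0 < (sval y).1 0)%N,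
  (sval y).2 = (sval x).2 `|` [set (sval x).1 0%N] &
  tv_le (rho ((sval x).1 0%N)) (range (sval y).1) (d / 4)].
have [x0 x0F] : exists x : St, (sval x).2 = set0.
  suff ix0 : inv (id, set0) by exists (exist _ _ ix0).
  split => //= j; rewrite fin_additive0// normr0; exact: ltW.
have step x : {y | next x y}.
  apply: cid; case: x => -[s F] [/= sS sF]; set n := s 0%N.
  pose rho' M := rho n (s @` M).
  have rD' : fin_additive rho'.
    move=> A C AC; rewrite /rho' image_setU rD//.
    apply/seteqP; split => // x [[a Aa <-] [b Cb /(homo_ltn_inj sS) ba]].
    by suff : (A `&` C) a; [rewrite AC|split => //; rewrite -ba].
  have rB' : tv_le rho' setT B.
    move=> S; have := tv_le_sub (rD n) (@subsetT _ (range s)) (rB n) (s @` S).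
    rewrite /rho'; congr (rho n _ - rho n _ <= B); apply/seteqP; split => x.
    - by move=> [_ [i Si <-]]; exists i.
    - by move=> [i [_ Si] <-]; split; exists i.
    - by move=> [[i _ <-] h]; exists i => //; split => // Si; apply: h; exists i.
    - move=> [i [_ Si] <-]; split; first by exists i.
      by move=> [j Sj /(homo_ltn_inj sS) ji]; apply: Si; rewrite -ji.
  (* With this many residue classes, [rho n] has variation at most [d / 4] along one of them. *)
  pose p := (Num.truncn (B / (d / 4))).+1.
  have pB : B <= d / 4 * #|[set: 'I_p]%SET|%:R.
    rewrite cardsT card_ord mulrC -ler_pdivrMr//; apply: ltW.
    by rewrite /p truncnS_gt.
  have [|r _ Hr] := tv_le_fiber rD' (fun i => inord (i %% p) : 'I_p) rB' _ pB.
    by rewrite -card_gt0 cardsT card_ord.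
  have {}Hr : tv_le (rho n) (s @` [set i | (i %% p)%N = r]) (d / 4).
    move=> S; have := Hr (s @^-1` S).
    have -> : [set t | inord (t %% p) = r] = [set i | (i %% p)%N = r].
      apply/seteqP; split => t /=; first by move=> <-; rewrite inordK// ltn_mod.
      by move=> tr; apply/val_inj; rewrite /= inordK// ltn_mod.
    congr (rho n _ - rho n _ <= _); apply/seteqP; split => x.
    - by move=> [i [ir Si] <-]; split => //; exists i.
    - by move=> [[i ir <-] Si]; exists i.
    - by move=> [i [ir Si] <-]; split => //; exists i.
    - by move=> [[i ir <-] Si]; exists i.
  have /cvgr0Pnorm_lt/(_ _ d4)[N _ HN] := r0 (F `|` [set n]).
  have /(@extract _ 0%N)[t [tS tP t0]] : forall k, exists2 j, (k < j)%N &
      (N <= j)%N /\ (j %% p)%N = r.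
    move=> k; exists (p * maxn k.+1 N + r)%N.
      rewrite (@leq_trans (maxn k.+1 N))// ?leq_max ?leqnn//.
      by rewrite (leq_trans _ (leq_addr _ _))// leq_pmull.
    split; last by rewrite mulnC modnMDl modn_small.
    rewrite (@leq_trans (maxn k.+1 N))// ?leq_max ?leqnn ?orbT//.
    by rewrite (leq_trans _ (leq_addr _ _))// leq_pmull.
  have iy : inv (s \o t, F `|` [set n]).
    split => [|j] /=; first exact: homo_ltn_comp.
    apply/ltW/HN => /=; have [/leq_trans + _] := tP j; apply.
    exact: homo_ltn_ge.
  exists (exist _ _ iy); split => //=.
  - by move=> _ [i _ <-]; exists (t i).
  - exact: sS.
  - apply: tv_le_sub Hr => // _ [i _ <-]; exists (t i) => //=.
    by have [] := tP i.
have [f [f0 fP]] := dependent_choice step x0.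
pose s k := (sval (f k)).1; pose n k := s k 0%N.
have nS : {homo n : i j / (i < j)%N}.
  by apply: homo_ltn => [|i]; [exact: ltn_trans|have [] := fP i].
have sR k l : (k <= l)%N -> range (s l) `<=` range (s k).
  elim: l => [|l IH]; first by rewrite leqn0 => /eqP ->.
  rewrite leq_eqVlt => /orP[/eqP -> //|/IH].
  by apply: subset_trans; have [] := fP l.
have FE k : (sval (f k)).2 = n @` [set i | (i < k)%N].
  elim: k => [|k IH]; first by rewrite f0 x0F; apply/seteqP; split => // x [].
  have [_ _ -> _] := fP k; rewrite IH -/(n k); apply/seteqP; split => x.
    by move=> [[i ik <-]|->]; [exists i => //=; exact: ltnW|exists k => /=].
  move=> [i /=]; rewrite ltnS leq_eqVlt => /orP[/eqP->|ik] <-; first by right.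
  by left; exists i.
(* On the set of all selected indices, the earlier and the later ones contribute at most [d / 4]
   each to [rho (n N)], and [n N] itself at least [d]; so the value cannot fall below [d / 4]. *)
have /cvgr0Pnorm_lt/(_ _ d4)[N _ HN] := r0 (range n).
have := HN (n N) (homo_ltn_ge N nS) => /=.
have -> : range n = ((sval (f N)).2 `|` [set n N]) `|` (n @` [set i | (N < i)%N]).
  rewrite FE; apply/seteqP; split => [_ [i _ <-]|].
    by case: (ltngtP i N) => [iN|iN|->]; [left; left|right|left; right] => //; exists i.
  by move=> _ [[[i _ <-]|->]|[i _ <-]].
have dis1 : ((sval (f N)).2 `|` [set n N]) `&` (n @` [set i | (N < i)%N]) = set0.
  apply/seteqP; split => // x; rewrite FE => -[hx [j /= Nj jx]]; move: hx; rewrite -jx.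
  move=> [[i /= iN]|] /(homo_ltn_inj nS) ij; first by move: (ltn_trans iN Nj); rewrite ij ltnn.
  by move: Nj; rewrite ij ltnn.
have dis2 : (sval (f N)).2 `&` [set n N] = set0.
  rewrite FE; apply/seteqP; split => // x [[i /= iN <-] /(homo_ltn_inj nS) ij].
  by move: iN; rewrite ij ltnn.
rewrite (rD (n N) _ _ dis1) (rD (n N) _ _ dis2).
have : `|rho (n N) (sval (f N)).2| <= d / 4 by have [_] := svalP (f N); exact.
have : `|rho (n N) (n @` [set i | (N < i)%N])| <= d / 4.
  have [_ _ _] := fP N; apply: tv_le_norm => // _ [i /= Ni <-].
  by apply: (sR _ _ Ni); exists 0%N.
have := Hd (n N).
move: (rho (n N) (sval _).2) (rho (n N) [set n N]) (rho (n N) (n @` _)) => x y z.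
rewrite !ler_norml ltr_norml ler_normr; lra.
Qed.

Lemma bigcup_fin_additive (T : Type) (V : zmodType) (nu : set T -> V) (A : nat -> set T) :
  fin_additive nu -> (forall i j, i <> j -> A i `&` A j = set0) ->
  fin_additive (fun M => nu (\bigcup_(i in M) A i)).
Proof.
move=> nuD Ad M N MN; rewrite bigcup_setU nuD//.
apply/seteqP; split => // x [[i Mi Aix] [j Nj Ajx]].
have [ij|ij] := pselect (i = j).
  by suff : (M `&` N) i; [rewrite MN|split => //; rewrite ij].
by rewrite -(Ad _ _ ij).
Qed.

Lemma bigcup_tv_le (R : realDomainType) (T : Type) (nu : set T -> R) (A : nat -> set T) B :
  fin_additive nu -> (forall i j, i <> j -> A i `&` A j = set0) ->
  tv_le nu setT B -> tv_le (fun M => nu (\bigcup_(i in M) A i)) setT B.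
Proof.
move=> nuD Ad nuB S.
have := tv_le_sub nuD (@subsetT _ (\bigcup_i A i)) nuB (\bigcup_(i in S) A i).
congr (nu _ - nu _ <= B); apply/seteqP; split => x.
- by move=> [_ [i Si Aix]]; exists i.
- by move=> [i [_ Si] Aix]; split; exists i.
- by move=> [[i _ Aix] h]; exists i => //; split => // Si; apply: h; exists i.
- move=> [i [_ Si] Aix]; split; first by exists i.
  move=> [j Sj Ajx]; have [ij|ij] := pselect (i = j); first by apply: Si; rewrite ij.
  by rewrite -[False]/(set0 x) -(Ad _ _ ij).
Qed.

Section null_sequences.
Context (R : realType) (T : Type) (sg : nat -> set T -> R) (B c : R).
Hypotheses (B0 : 0 < B) (c0 : 0 < c) (sgD : forall n, fin_additive (sg n)).
Hypothesis sgB : forall n, tv_le (sg n) setT B.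

(* Setwise convergence in [ba(T)] forces weak convergence (Grothendieck), so a
   setwise null sequence cannot be equivalent to the basis of l^1. *)
Lemma setwise_null_signs : (forall A, sg n A @[n --> \oo] --> 0) ->
  exists (s : nat -> nat) (m : nat) (e : {ffun 'I_m -> bool}),
    {homo s : i j / (i < j)%N} /\
    forall S, \sum_i (-1) ^+ e i * (sg (s i) S - sg (s i) (~` S)) < c * m%:R.
Proof.
move=> sg0; apply: contrapT => Hn.
have Hc s m (e : {ffun 'I_m -> bool}) : {homo s : i j / (i < j)%N} ->
    exists S, c * m%:R <= \sum_i (-1) ^+ e i * (sg (s i) S - sg (s i) (~` S)).
  move=> sS; apply: contrapT => /forallNP HS; apply: Hn; exists s, m, e; split => // S.
  by rewrite ltNge; apply/negP/HS.
pose d := (c / 2) ^+ 2 / (4 * B).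
have c2 : 0 < c / 2 by rewrite divr_gt0.
have d0 : 0 < d by apply: divr_gt0; rewrite ?exprn_gt0 ?mulr_gt0.
(* State: [x.1] enumerates the charges still available, [x.2] is the union of the blocks already
   chosen. Variation below [c / 4] there leaves signed sums of at least [c / 2] per term outside. *)
pose inv (x : (nat -> nat) * set T) :=
  {homo x.1 : i j / (i < j)%N} /\
  exists2 b, b < c / 4 & forall j, tv_le (sg (x.1 j)) x.2 b.
pose St := {x | inv x}.
pose next (x y : St * (nat * set T)) := [/\ range (sval y.1).1 `<=` range (sval x.1).1,
  range (sval x.1).1 y.2.1,
  forall j, (y.2.1 < (sval y.1).1 j)%N,
  (sval y.1).2 = (sval x.1).2 `|` y.2.2 &
  (sval x.1).2 `&` y.2.2 = set0 /\ d <= `|sg y.2.1 y.2.2|].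
have x0 : St.
  suff ix0 : inv (id, set0) by exact: exist _ _ ix0.
  split => //=; exists 0; first by rewrite divr_gt0.
  by move=> j S; rewrite set0I set0D subrr.
have step x : {y | next x y}.
  apply: cid; case: x => -[[s W] [/= sS [b bc sW]]] [n A] /=.
  have H1 n' : fin_additive (fun A => sg (s n') (A `&` ~` W)).
    exact: fin_additive_restr.
  have H2 n' : tv_le (fun A => sg (s n') (A `&` ~` W)) setT B.
    move=> S; have := tv_le_sub (sgD (s n')) (@subsetT _ (~` W)) (sgB (s n')) S.
    by congr (sg _ _ - sg _ _ <= B); rewrite ?setTI ?setTD setIC.
  have H3 m (e : {ffun 'I_m -> bool}) : exists S, c / 2 * m%:R <=
      \sum_i (-1) ^+ e i * (sg (s i) (S `&` ~` W) - sg (s i) (~` S `&` ~` W)).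
    have [S HS] := Hc s m e sS; exists S.
    have -> : c / 2 * m%:R = c * m%:R - \sum_(i < m) (c / 2).
      by rewrite sumr_const card_ord -mulr_natr; field.
    rewrite lerBlDr; apply: le_trans HS _; rewrite -big_split /=.
    apply: ler_sum => i _.
    rewrite (fin_additiveID (sgD (s i)) S W) (fin_additiveID (sgD (s i)) (~` S) W).
    have := sW i S; have := sW i (~` S); rewrite !setDE !setCK ![W `&` _]setIC.
    by case: (e i); rewrite ?expr1 ?expr0; lra.
  (* Only half of the room left below [c / 4] is spent, so the construction can go on forever. *)
  have h0 : 0 < (c / 4 - b) / 2 by rewrite divr_gt0// subr_gt0.
  have [i [A' [dA' HA']]] := split_step B0 c2 H1 H2 H3 h0.
  have [t [tS tP ti]] := extract i HA'.
  pose A'' := A' `&` ~` W.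
  have iy : inv (s \o t, W `|` A'').
    split; first exact: homo_ltn_comp.
    exists (b + (c / 4 - b) / 2) => [|j]; first by lra.
    apply: tv_leU => //= S; have := tP j S; rewrite /A''.
    by congr (sg _ _ - sg _ _ <= _); rewrite ?setDE setIAC.
  exists (exist _ _ iy, (s i, A'')); split => //=.
  - by move=> _ [k _ <-]; exists (t k).
  - by exists i.
  - by move=> j; apply: sS.
  - by split => //; rewrite /A'' setICA setICr setI0.
have [f [f0 fP]] := dependent_choice step (x0, (0%N, set0)).
pose u k := (f k.+1).2.1; pose A k := (f k.+1).2.2; pose W k := (sval (f k).1).2.
have uS : {homo u : i j / (i < j)%N}.
  apply: homo_ltn => [|i]; first exact: ltn_trans.
  have [_ _ + _ _] := fP i; have [_ [j _ uj] _ _ _] := fP i.+1.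
  by move=> /(_ j); rewrite uj.
have AW i j : (i < j)%N -> A i `<=` W j.
  elim: j => // j IH; rewrite ltnS leq_eqVlt => /orP[/eqP->|/IH] Aj;
    rewrite /W; have [_ _ _ -> _] := fP j.
  - by move=> x; right.
  - by move=> x /Aj; left.
have Ad' i j : (i < j)%N -> A i `&` A j = set0.
  move=> ij; have [_ _ _ _ [WA _]] := fP j.
  by rewrite -subset0 -WA; apply: setSI; exact: AW.
have Ad i j : i <> j -> A i `&` A j = set0.
  by move=> /eqP; rewrite neq_ltn => /orP[/Ad'//|/Ad']; rewrite setIC.
(* Regarded as charges on the indices of the disjoint blocks [A i], the [sg (u k)] are setwise null,
   yet each has at least [d] on its own block. *)
have [|||k] := @phillips R (fun k M => sg (u k) (\bigcup_(i in M) A i)) B d d0.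
- by move=> k; exact: bigcup_fin_additive.
- by move=> k; exact: bigcup_tv_le.
- move=> M; apply: (@cvg_comp _ _ _ u (fun n => sg n (\bigcup_(i in M) A i)) \oo \oo); last exact: sg0.
  by move=> P [N _ HN]; exists N => // i Ni; apply: HN; exact: leq_trans Ni (homo_ltn_ge i uS).
- rewrite /= bigcup_set1; apply/negP; rewrite -leNgt.
  by have [_ _ _ _ []] := fP k.
Qed.
End null_sequences.

(** * Duals and weak-* decompositions *)

Lemma linear_bounded (R : realType) (V W : normedModType R) (f : V -> W) :
  linear f -> continuous f -> exists2 M, 0 < M & forall v, `|f v| <= M * `|v|.
Proof.
move=> lf cf.
pose fl : {linear V -> W} := HB.pack f (GRing.isLinear.Build _ _ _ _ f lf).
have : bounded_near fl (nbhs (0 : V)).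
  by apply: (@continuous_linear_bounded _ _ _ 0 fl); exact: cf.
move=> /linear_boundedP[M [_ HM]]; exists (`|M| + 1); first by rewrite ltr_pwDr.
by move=> v; apply: HM; rewrite ltr_pwDr// ler_norm.
Qed.

Lemma bounded_linear_continuous (R : realType) (V W : normedModType R) (f : V -> W) M :
  linear f -> (forall v, `|f v| <= M * `|v|) -> continuous f.
Proof.
move=> lf fM.
pose fl : {linear V -> W} := HB.pack f (GRing.isLinear.Build _ _ _ _ f lf).
apply: (@bounded_linear_continuous _ _ _ fl).
apply/linear_boundedP; exists M; split; first exact: num_real.
by move=> N /ltW MN v; apply: le_trans (fM v) _; exact: ler_wpM2r.
Qed.

Section dual.
Context (R : realType) (X : normedModType R).
Implicit Types f g : dual X.

Lemma dual_fun_linear f : linear (dual_fun f).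
Proof. by have /asboolP[] := valP f. Qed.

Lemma dual_fun_continuous f : continuous (dual_fun f).
Proof. by have /asboolP[] := valP f. Qed.

HB.instance Definition _ f :=
  GRing.isLinear.Build _ _ _ _ (dual_fun f) (@dual_fun_linear f).

Lemma dual_funD f g x : dual_fun (f + g) x = dual_fun f x + dual_fun g x.
Proof. by []. Qed.

Lemma dual_funZ a f x : dual_fun (a *: f) x = a * dual_fun f x.
Proof. by []. Qed.

Lemma dual_funB f g x : dual_fun (f - g) x = dual_fun f x - dual_fun g x.
Proof. by []. Qed.

Lemma dual_fun0 x : dual_fun (0 : dual X) x = 0.
Proof. by []. Qed.

Lemma dual_fun_sum (I : Type) (s : seq I) (P : pred I) (F : I -> dual X) x :
  dual_fun (\sum_(i <- s | P i) F i) x = \sum_(i <- s | P i) dual_fun (F i) x.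
Proof. by elim/big_rec2: _ => // i y1 y2 _ <-. Qed.

Lemma dual_eq f g : (forall x, dual_fun f x = dual_fun g x) -> f = g.
Proof. by move=> fg; apply/val_inj/funext. Qed.

Lemma dual_normE f : `|f| = sup [set `|dual_fun f x| | x in [set x | `|x| <= 1]].
Proof. by []. Qed.

Lemma dual_norm_ge f x : `|x| <= 1 -> `|dual_fun f x| <= `|f|.
Proof.
move=> x1; rewrite dual_normE; apply: ub_le_sup; last by exists x.
have [M M0 HM] := linear_bounded (dual_fun_linear f) (@dual_fun_continuous f).
exists M => _ [y /= y1 <-]; apply: le_trans (HM y) _.
by rewrite ler_piMr// ltW.
Qed.

Lemma dual_fun_le f x : `|dual_fun f x| <= `|f| * `|x|.
Proof.
have [->|x0] := eqVneq x 0; first by rewrite linear0 !normr0 mulr0.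
rewrite -ler_pdivrMr ?normr_gt0//.
have := @dual_norm_ge f (`|x|^-1 *: x).
rewrite normrZ normfV normr_id mulVf ?normr_eq0// lexx => /(_ isT).
by rewrite linearZ /= normrZ normfV normr_id mulrC.
Qed.

Lemma dual_norm_le f M : (forall x, `|x| <= 1 -> dual_fun f x <= M) -> `|f| <= M.
Proof.
move=> fM; rewrite dual_normE; apply: ge_sup.
  by exists `|dual_fun f 0|, 0 => //=; rewrite normr0.
move=> _ [x /= x1 <-]; rewrite ler_norml fM// lerNl -linearN fM ?normrN//.
Qed.

Lemma dual_norm_gt f s : s < `|f| -> exists2 x, `|x| <= 1 & s < dual_fun f x.
Proof.
move=> sf; apply: contrapT => nf; move: sf; apply/negP; rewrite -leNgt.
apply: dual_norm_le => x x1; rewrite leNgt; apply/negP => sx.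
by apply: nf; exists x.
Qed.

Lemma insubd_dual (g : X -> R) M : linear g -> (forall x, `|g x| <= M * `|x|) ->
  dual_fun (insubd (0 : dual X) g) = g.
Proof.
move=> lg gM; rewrite /dual_fun val_insubd ifT//; apply/asboolP; split => //.
exact: (@bounded_linear_continuous R X R^o g M lg gM).
Qed.

(** Weak-* lower semicontinuity of the norm: a vector of the unit ball where [f] exceeds [s] is a
    witness for almost all [u n]. *)
Lemma dual_norm_lsc (u : nat -> dual X) f s :
  (forall x, dual_fun (u n) x @[n --> \oo] --> dual_fun f x) -> s < `|f| ->
  \forall n \near \oo, s < `|u n|.
Proof.
move=> uf /dual_norm_gt[x x1 sx].
have := uf x; move/cvgr_gt => /(_ _ sx); apply: filterS => n /lt_le_trans; apply.
by apply: le_trans (dual_norm_ge _ x1); exact: ler_norm.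
Qed.

Lemma dual_sum_norm_lsc (I : finType) (u : nat -> I -> dual X) (f : I -> dual X) s :
  (forall i x, dual_fun (u n i) x @[n --> \oo] --> dual_fun (f i) x) ->
  s < \sum_i `|f i| -> \forall n \near \oo, s < \sum_i `|u n i|.
Proof.
(* Dividing by one more than the number of summands keeps the total loss strictly below the gap. *)
move=> uf sf; pose e := (\sum_i `|f i| - s) / (#|I|.+1)%:R.
have e0 : 0 < e by rewrite divr_gt0// subr_gt0.
have : \forall n \near \oo, forall i, `|f i| - e < `|u n i|.
  apply: filter_forall => i; apply: dual_norm_lsc; first exact: uf.
  by rewrite ltrBlDr ltrDl.
apply: filterS => n Hn; apply: (@lt_le_trans _ _ (\sum_i (`|f i| - e))); last first.
  by apply: ler_sum => i _; exact: ltW.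
rewrite sumrB sumr_const ltrBrDl -ltrBrDr -mulr_natr /e.
rewrite mulrAC ltr_pdivrMr ?ltr0n// ltr_pM2l ?subr_gt0//.
by rewrite ltr_nat.
Qed.

(** A finite rank operator on the dual that reads [f] only through its values at finitely many
    points of [X]. *)
Definition rank_op (s : seq (X * dual X)) f := \sum_(p <- s) dual_fun f p.1 *: p.2.

Lemma rank_op_linear s : linear (rank_op s).
Proof.
move=> a f g; rewrite /rank_op scaler_sumr -big_split; apply: eq_bigr => p _ /=.
by rewrite dual_funD dual_funZ scalerDl scalerA.
Qed.

HB.instance Definition _ s := GRing.isLinear.Build _ _ _ _ (rank_op s) (rank_op_linear s).

(** To fix one more [b], the operator is corrected by a multiple of the residue [r] of [b], measured
    at a point where [r] is nonzero; the correction vanishes on functionals already fixed. *)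
Lemma rank_op_fix (bs : seq (dual X)) :
  exists s, forall b, b \in bs -> rank_op s b = b.
Proof.
elim: bs => [|b bs [s IH]]; first by exists [::].
pose r := b - rank_op s b; have [r0|/eqP r0] := eqVneq r 0.
  exists s => g; rewrite inE => /orP[/eqP->|/IH//].
  by apply/eqP; rewrite eq_sym -subr_eq0; apply/eqP.
have [x rx] : exists x, dual_fun r x != 0.
  apply: contrapT => /forallNP rx; apply: r0; apply: dual_eq => x.
  by rewrite dual_fun0; apply/eqP/negPn/negP; exact: rx.
pose s' := (x, (dual_fun r x)^-1 *: r) ::
  [seq (p.1, p.2 - (dual_fun p.2 x / dual_fun r x) *: r) | p <- s].
have s'E f : rank_op s' f =
    rank_op s f + (dual_fun (f - rank_op s f) x / dual_fun r x) *: r.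
  rewrite {1}/rank_op big_cons big_map /=.
  under eq_bigr do rewrite scalerBr scalerA mulrA.
  rewrite sumrB -scaler_suml -mulr_suml addrC -addrA; congr (_ + _).
  rewrite dual_funB /rank_op dual_fun_sum scalerA addrC -scalerBl -mulrBl.
  by congr ((_ - _) / _ *: _); apply: eq_bigr => p _; rewrite dual_funZ.
exists s' => g; rewrite inE s'E => /orP[/eqP->|/IH->].
  by rewrite -/r divff// scale1r /r addrC subrK.
by rewrite subrr dual_fun0 mul0r scale0r addr0.
Qed.
End dual.

Section FDD.
Context (R : realType) (X : normedModType R) (E : nat -> set (dual X)).
Hypotheses (FE : wstar_FDD E) (mE : monotone_FDD E).
Local Notation P := (FDD_proj E).

Let exp_ f := xget (fun=> 0) [set u | wstar_expansion E f u].

Let exp_P f : wstar_expansion E f (exp_ f).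
Proof.
have [_ /(_ f)[u [uf _]] _ _] := FE.
by apply: (@xgetPex _ _ [set u | wstar_expansion E f u]); exists u.
Qed.

Let exp_eq f u : wstar_expansion E f u -> exp_ f = u.
Proof.
have [_ /(_ f)[v [_ vu]] _ _] := FE.
by move=> /vu <-; apply/esym/vu; exact: exp_P.
Qed.

Let E_lin m a u v : E m u -> E m v -> E m (a *: u + v).
Proof.
have [/(_ m)[n [b ->]] _ _ _] := FE => -[c _ <-] [c' _ <-].
exists (fun i => a * c i + c' i) => //; rewrite scaler_sumr -big_split.
by apply: eq_bigr => i _ /=; rewrite scalerDl scalerA.
Qed.

Lemma FDD_projE f j : P j f = series (exp_ f) j.+1.
Proof. by rewrite /FDD_proj /series /= big_mkord. Qed.

(** By uniqueness, the termwise combination of two expansions is the expansion of the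
    combination. *)
Lemma FDD_proj_linear j : linear (P j).
Proof.
move=> a f g; rewrite !FDD_projE.
have -> : exp_ (a *: f + g) = (fun m => a *: exp_ f m + exp_ g m).
  apply: exp_eq; have [fE fc] := exp_P f; have [gE gc] := exp_P g; split.
    by move=> m; exact: E_lin.
  move/weak_star_cvgP : fc => fc; move/weak_star_cvgP : gc => gc.
  apply/weak_star_cvgP => x.
  have -> : (fun n => dual_fun (series (fun m => a *: exp_ f m + exp_ g m) n) x) =
    (fun n => a * dual_fun (series (exp_ f) n) x + dual_fun (series (exp_ g) n) x).
    apply/funext => n; rewrite /series /= big_split /= -scaler_sumr.
    by rewrite dual_funD dual_funZ.
  rewrite dual_funD dual_funZ; apply: cvgD (gc x).
  exact: cvgMr (fc x).
by rewrite /series /= big_split /= scaler_sumr.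
Qed.

HB.instance Definition _ j := GRing.isLinear.Build _ _ _ _ (P j) (@FDD_proj_linear j).

Lemma FDD_proj_cvg f x : dual_fun (P j f) x @[j --> \oo] --> dual_fun f x.
Proof.
have [_ /weak_star_cvgP /(_ x)] := exp_P f.
rewrite -(cvg_shiftS (fun n => dual_fun (series (exp_ f) n) x)).
by under [X in _ -> X @ _ --> _]eq_fun do rewrite FDD_projE.
Qed.

Lemma FDD_proj_norm j f : `|P j f| <= `|f|.
Proof.
have [_ _ /(_ j)[M HM] _] := FE.
have H g : `|g| <= 1 -> `|P j g| <= 1.
  move=> g1; apply: le_trans (mE j); apply: ub_le_sup; last by exists g.
  exists (`|M|) => _ [h /= h1 <-]; apply: le_trans (HM h) _.
  by apply: le_trans (ler_wpM2r (normr_ge0 _) (ler_norm M)) _; rewrite ler_piMr.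
have [->|f0] := eqVneq f 0; first by rewrite linear0 !normr0.
have := H (`|f|^-1 *: f); rewrite normrZ normfV normr_id mulVf ?normr_eq0//.
rewrite lexx linearZ /= normrZ normfV normr_id => /(_ isT).
by rewrite ler_pdivrMl ?normr_gt0// mulr1.
Qed.

Lemma FDD_proj_wstar j (u : nat -> dual X) f :
  (forall x, dual_fun (u n) x @[n --> \oo] --> dual_fun f x) ->
  forall x, dual_fun (P j (u n)) x @[n --> \oo] --> dual_fun (P j f) x.
Proof.
move=> /weak_star_cvgP uf; apply/weak_star_cvgP.
have [_ _ _ /(_ j) cP] := FE.
exact: (@cvg_comp _ _ _ (u : nat -> weak_star X) (P j : weak_star X -> weak_star X) _ _ _ uf (cP f)).
Qed.

Lemma FDD_proj_finite j : exists s : seq (X * dual X), forall f, rank_op s (P j f) = P j f.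
Proof.
have [fdE _ _ _] := FE.
have /choice[bs Hbs] : forall m, exists bs : seq (dual X),
    forall s, (forall b, b \in bs -> rank_op s b = b) -> forall f, E m f -> rank_op s f = f.
  move=> m; have [n [b ->]] := fdE m; exists (codom b) => s Hs f [c _ <-].
  rewrite linear_sum; apply: eq_bigr => i _; rewrite linearZ /= Hs//.
  exact: codom_f.
have [s Hs] := rank_op_fix (flatten [seq bs m | m <- iota 0 j.+1]).
exists s => f; rewrite FDD_projE /series /= big_mkord linear_sum; apply: eq_bigr => m _ /=.
apply: (Hbs m); last by have [] := exp_P f.
move=> b bm; apply: Hs; apply/flattenP; exists (bs m) => //.
by apply: map_f; rewrite mem_iota /=.
Qed.
End FDD.

(** * Functions on [1, omega] x beta N *)

Section cont_space.
Context (R : realType) (K : compHausType) (X : normedModType R).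
Implicit Types f g : cont_space K X.

Lemma cont_fun_continuous f : continuous (cont_fun f).
Proof. by have /asboolP := valP f. Qed.

Lemma cont_funD f g k : cont_fun (f + g) k = cont_fun f k + cont_fun g k.
Proof. by []. Qed.

Lemma cont_funB f g k : cont_fun (f - g) k = cont_fun f k - cont_fun g k.
Proof. by []. Qed.

Lemma cont_funZ a f k : cont_fun (a *: f) k = a *: cont_fun f k.
Proof. by []. Qed.

Lemma cont_fun_sum (I : Type) (s : seq I) (P : pred I) (F : I -> cont_space K X) k :
  cont_fun (\sum_(i <- s | P i) F i) k = \sum_(i <- s | P i) cont_fun (F i) k.
Proof. by elim/big_rec2: _ => // i y1 y2 _ <-. Qed.

Lemma cont_eq f g : (forall k, cont_fun f k = cont_fun g k) -> f = g.
Proof. by move=> fg; apply/val_inj/funext. Qed.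

Lemma cont_normE f : `|f| = sup [set `|cont_fun f k| | k in [set: K]].
Proof. by []. Qed.

Lemma cont_norm_ge f k : `|cont_fun f k| <= `|f|.
Proof.
rewrite cont_normE; apply: ub_le_sup; last by exists k.
have /compact_bounded[M [_ /(_ (M + 1)) HM]] : compact (cont_fun f @` setT).
  apply: continuous_compact; last exact: compT.
  by apply: continuous_subspaceT; exact: cont_fun_continuous.
exists (M + 1) => _ [l _ <-]; apply: HM; first by rewrite ltrDl.
by exists l.
Qed.

Lemma cont_norm_le f M : 0 <= M -> (forall k, `|cont_fun f k| <= M) -> `|f| <= M.
Proof.
move=> M0 fM; rewrite cont_normE; have [[k _]|K0] := pselect ([set: K] !=set0).
  by apply: ge_sup; [exists `|cont_fun f k|, k|move=> _ [l _ <-]].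
rewrite (_ : [set _ | _ in _] = set0) ?sup0 //.
by apply/seteqP; split => // x [k _ _]; apply: K0; exists k.
Qed.

Lemma insubd_cont (h : K -> X) : continuous h ->
  cont_fun (insubd (0 : cont_space K X) h) = h.
Proof. by move=> ch; rewrite /cont_fun val_insubd ifT//; apply/asboolP. Qed.
End cont_space.

(** Sets whose complement is covered by finitely many [C z] form a filter. Without a finite cover it
    is proper, but it has no cluster point [z], since it contains the complement of [C z]. *)
Lemma compact_finite_cover (T : topologicalType) (C : T -> set T) :
  compact [set: T] -> (forall z, nbhs z (C z)) ->
  exists s : seq T, forall w, exists2 z, z \in s & C z w.
Proof.
move=> cT zC; apply: contrapT => /forallNP nC.
pose F : set_system T := [set A | exists s : seq T, forall w, ~ A w -> exists2 z, z \in s & C z w].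
have FF : ProperFilter F.
  apply: Build_ProperFilter_ex => [A [s As]|].
    by apply: contrapT => /forallNP nA; apply: (nC s) => w; exact/As/nA.
  split=> [|A B [s As] [t Bt]|A B AB [s As]].
  - by exists [::] => w /(_ I).
  - exists (s ++ t) => w /not_andP[/As|/Bt] [z zs Cz]; exists z => //;
      by rewrite mem_cat zs ?orbT.
  - by exists s => w nB; apply: As => /AB.
have [|z [_ zF]] := cT F FF; first by exists [::] => w /(_ I).
have [||w [nCz /nCz//]] := zF (~` C z) (C z); last exact: zC.
by exists [:: z] => w /contrapT Czw; exists z; rewrite ?mem_head.
Qed.

Section interval1.
Context d (A : wellOrderType d).
Implicit Types x y : interval1 A.

Lemma interval1_ltE x y : (x < y)%O = ~~ upto_le (val y) (val x).
Proof. by rewrite ltNge. Qed.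

Lemma interval1_gt_open x : open [set y : interval1 A | ~~ upto_le (val y) (val x)].
Proof.
have := @rray_open _ (interval1 A) x; congr open.
by apply/seteqP; split => y /=; rewrite in_itv/= andbT interval1_ltE.
Qed.

Lemma interval1_lt_open x : open [set y : interval1 A | ~~ upto_le (val x) (val y)].
Proof.
have := @lray_open _ (interval1 A) x; congr open.
by apply/seteqP; split => y /=; rewrite in_itv/= interval1_ltE.
Qed.

Lemma interval1_nbhs x (U : set (interval1 A)) : nbhs x U ->
  exists l r : option (interval1 A),
    [/\ if l is Some a then ~~ upto_le (val x) (val a) : Prop else True,
        if r is Some b then ~~ upto_le (val b) (val x) : Prop else True &
        forall y, (if l is Some a then ~~ upto_le (val y) (val a) : Prop else True) ->
          (if r is Some b then ~~ upto_le (val b) (val y) : Prop else True) -> U y].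
Proof.
rewrite itv_nbhsE => -[i [oi xi] iU].
case: i oi xi iU => [[[] l|[]] [[] r|[]]]//=; rewrite ?in_itv /= => _ xi iU.
- move: xi => /andP[lx xr]; exists (Some l), (Some r); rewrite -!interval1_ltE; split => // y.
  by rewrite -!interval1_ltE => ly yr; apply: iU; rewrite /= in_itv/= ly yr.
- move: xi; rewrite andbT => lx; exists (Some l), None; rewrite -!interval1_ltE; split => // y.
  by rewrite -!interval1_ltE => ly _; apply: iU; rewrite /= in_itv/= ly.
- exists None, (Some r); rewrite -!interval1_ltE; split => // y.
  by rewrite -!interval1_ltE => _ yr; apply: iU; rewrite /= in_itv/= yr.
- by exists None, None; split => // y _ _; apply: iU; rewrite /= in_itv.
Qed.
End interval1.

Section interval1_nat.
Implicit Types a : interval1 nat.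

(** A locally constant map that separates the ordinals up to [N] and collapses the clopen tail ]N,
    omega] to [N.+1]. *)
Definition trunc_ord N a : nat := if val a is Some n then minn n N.+1 else N.+1.

Lemma trunc_ord_le N a : (trunc_ord N a <= N.+1)%N.
Proof. by rewrite /trunc_ord; case: (val a) => // n; exact: geq_minr. Qed.

Lemma trunc_ord_min N M a : (N <= M)%N -> trunc_ord N a = minn (trunc_ord M a) N.+1.
Proof.
rewrite /trunc_ord; case: (val a) => [n|] NM; last by rewrite (minn_idPr _).
by rewrite -minnA; congr minn; rewrite (minn_idPr _).
Qed.

Let pt n (n0 : Some n != Some \bot%O :> upto nat) : interval1 nat :=
  exist (fun x : upto nat => x != Some \bot%O) (Some n) n0.

Lemma trunc_ord_nbhs N a : nbhs a [set b | trunc_ord N b = trunc_ord N a].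
Proof.
have gtS n : open [set b : interval1 nat | if val b is Some m then (n < m)%N else true].
  case: n => [|n].
    rewrite (_ : [set _ | _] = setT); first exact: openT.
    apply/seteqP; split => // -[[m|] hm] _ //=.
    by rewrite lt0n; apply: contra hm => /eqP ->.
  have n0 : Some n.+1 != Some \bot%O :> upto nat by [].
  have := interval1_gt_open (pt n0); congr open.
  by apply/seteqP; split => -[[m|] hm] //=; rewrite leEnat -ltnNge.
have ltS n : open [set b : interval1 nat | if val b is Some m then (m < n)%N else false].
  case: n => [|n].
    rewrite (_ : [set _ | _] = set0); first exact: open0.
    by apply/seteqP; split => // -[[m|] hm].
  have n0 : Some n.+1 != Some \bot%O :> upto nat by [].
  have := interval1_lt_open (pt n0); congr open.
  by apply/seteqP; split => -[[m|] hm] //=; rewrite leEnat -ltnNge.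
have [Na|aN] := leqP N.+1 (trunc_ord N a).
  have {}Na : trunc_ord N a = N.+1 by apply/eqP; rewrite eqn_leq Na trunc_ord_le.
  apply: (@filterS _ _ _ [set b : interval1 nat | if val b is Some m then (N < m)%N else true]).
    by move=> [[m|] hm] /=; rewrite Na /trunc_ord //= => Nm; rewrite (minn_idPr _).
  apply: open_nbhs_nbhs; split; first exact: gtS.
  by move: Na; rewrite /trunc_ord /=; case: (val a) => // m Nm; rewrite -Nm geq_minl.
case: a aN => -[m|] hm; rewrite /trunc_ord /=; last by rewrite ltnn.
rewrite gtn_min ltnn orbF => mN; rewrite (minn_idPl (ltnW mN)).
have m0 : (0 < m)%N by rewrite lt0n; apply: contra hm => /eqP ->.
apply: (@filterS _ _ _ ([set b : interval1 nat | if val b is Some m' then (m.-1 < m')%N else true] `&`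
   [set b : interval1 nat | if val b is Some m' then (m' < m.+1)%N else false])).
  move=> [[m'|] hm'] /= [//]; rewrite prednK// ltnS => h1 h2.
  by have -> : m' = m by [apply/eqP; rewrite eqn_leq h1 h2]; rewrite (minn_idPl (ltnW mN)).
by apply: filterI; apply: open_nbhs_nbhs; split => //=; rewrite ?prednK.
Qed.

(** A finite ordinal [n] is isolated at level [n], and a neighbourhood of omega contains a tail; so
    the fibres form a neighbourhood base. *)
Lemma nbhs_trunc_ord a U : nbhs a U -> exists N, forall b, trunc_ord N b = trunc_ord N a -> U b.
Proof.
move=> aU; have [[n an]|an] : (exists n, val a = Some n) \/ val a = None.
- by case: (val a) => [n|]; [left; exists n|right].
- exists n => b; rewrite /trunc_ord an (minn_idPl (leqnSn _)) => bn.
  have -> : b = a; last exact: nbhs_singleton.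
  apply/val_inj; rewrite an; move: bn; case: (val b) => [m|]; last by lia.
  by move=> h; congr Some; lia.
have [l [r [la ra lrU]]] := interval1_nbhs aU.
have {ra}r0 : r = None by case: r ra lrU => // r; rewrite an; case: (val r).
case: l la lrU => [l|]; rewrite ?an; last first.
  by move=> _ lrU; exists 0%N => b _; apply: lrU; rewrite ?r0.
case ln: (val l) => [n|] // _ lrU; exists n => b; rewrite /trunc_ord an => bn.
apply: lrU; rewrite ?r0//; move: bn; case: (val b) => [m|] //=.
by rewrite leEnat -ltnNge; lia.
Qed.
End interval1_nat.

(** * Clopen sets and simple functions *)

Section simple_functions.
Context (R : realType) (X : normedModType R).
Local Notation K := (interval1 nat * beta nat)%type.
Local Notation Y := (cont_space K X).
Implicit Types (E A : set (nat * nat)) (x : X) (N : nat).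

(** [(a, F)] lies in the clopen set that [E] stands for: the first coordinate is
    read up to [N], the index [N.+1] stands for all the ordinals [> N]. *)
Definition in_clopen N E (z : K) : Prop :=
  sval z.2 [set k | E (trunc_ord N z.1, k)].

Let beta_ultra (F : beta nat) : UltraFilter (sval F) := svalP F.

Lemma in_clopenC N E z : in_clopen N (~` E) z <-> ~ in_clopen N E z.
Proof.
have U := beta_ultra z.2; rewrite /in_clopen; split=> [h1 h2|h].
  have [k []] := @filter_ex _ (sval z.2) _ _ (@filterI _ (sval z.2) _ _ _ h1 h2).
  by [].
by have [/h//|] := in_ultra_setVsetC [set k | E (trunc_ord N z.1, k)] U.
Qed.

Lemma in_clopenI N E A z : in_clopen N (E `&` A) z <-> in_clopen N E z /\ in_clopen N A z.
Proof.
have U := beta_ultra z.2; rewrite /in_clopen; split=> [h|[h1 h2]].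
  by split; apply: filterS h => k [].
exact: (@filterI _ (sval z.2) _ _ _ h1 h2).
Qed.

Lemma in_clopen0 N z : ~ in_clopen N set0 z.
Proof.
have U := beta_ultra z.2; move=> /(@filter_ex _ (sval z.2) _ _)[k]; exact.
Qed.

Lemma in_clopenU N E A z : in_clopen N (E `|` A) z <-> in_clopen N E z \/ in_clopen N A z.
Proof.
rewrite -[E `|` A]setCK setCU in_clopenC in_clopenI !in_clopenC.
by split=> [/not_andP[/contrapT|/contrapT]|[h|h] []]; [left|right| |].
Qed.

Lemma in_clopen_nbhs N E z : in_clopen N E z -> nbhs z (in_clopen N E).
Proof.
case: z => a F EF.
exists ([set b | trunc_ord N b = trunc_ord N a],
        beta_open [set k | E (trunc_ord N a, k)]).
  split; first exact: trunc_ord_nbhs.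
  by apply/nbhs_beta; exists [set k | E (trunc_ord N a, k)].
by move=> [b G] /= [ba GE]; rewrite /in_clopen /= ba.
Qed.

Lemma nbhs_in_clopen z U : nbhs z U -> exists N E,
  in_clopen N E z /\ in_clopen N E `<=` U.
Proof.
case: z => a F [[P Q] [/= aP /nbhs_beta[A FA AQ]] PQ].
have [N HN] := nbhs_trunc_ord aP.
have U1 := beta_ultra F.
exists N, [set p | p.1 = trunc_ord N a /\ A p.2]; split.
  by apply: filterS FA => k Ak.
move=> [b G] h; apply: PQ; have U2 := beta_ultra G; split => /=.
  by apply: HN; have [k []] := @filter_ex _ (sval G) _ _ h.
by apply: AQ; apply: filterS h => k [].
Qed.

(** Preimages under this map encode a clopen set of level [N] at any finer level. *)
Definition trunc_pair N (p : nat * nat) := (minn p.1 N.+1, p.2).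

Lemma in_clopen_trunc N M E z : (N <= M)%N ->
  in_clopen M (trunc_pair N @^-1` E) z = in_clopen N E z.
Proof. by move=> NM; rewrite /in_clopen /trunc_pair/= -(trunc_ord_min _ NM). Qed.

Lemma in_clopen_agree N E A z : (forall i k, (i <= N.+1)%N -> E (i, k) <-> A (i, k)) ->
  in_clopen N E z = in_clopen N A z.
Proof.
move=> EA; rewrite /in_clopen; congr (sval z.2 _).
by apply/seteqP; split => k /=; apply: (EA _ _ _).1 || apply: (EA _ _ _).2;
  exact: trunc_ord_le.
Qed.

(** An ultrafilter contains exactly one cell of a finite partition, so finite colourings of
    [nat * nat] induce clopen partitions. *)
Lemma in_clopen_fiber (I : finType) (c : nat * nat -> I) N z :
  exists2 i, in_clopen N [set p | c p = i] z &
    forall j, in_clopen N [set p | c p = j] z -> j = i.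
Proof.
have U := beta_ultra z.2.
have [i ci] : exists i, in_clopen N [set p | c p = i] z.
  apply: contrapT => /forallNP H.
  have : \forall k \near sval z.2, forall i, ~ (c (trunc_ord N z.1, k) = i).
    by apply: filter_forall => i; have := H i; rewrite -in_clopenC.
  move=> h; have [k hk] := @filter_ex _ (sval z.2) _ _ h; exact: (hk _ erefl).
exists i => // j cj.
have h : in_clopen N ([set p | c p = i] `&` [set p | c p = j]) z by apply/in_clopenI.
by have [k [/= <- <-]] := @filter_ex _ (sval z.2) _ _ h.
Qed.

Definition clopen_val N E x (z : K) : X := if `[< in_clopen N E z >] then x else 0.

Lemma clopen_val_continuous N E x : continuous (clopen_val N E x).
Proof.
move=> z; apply: (@near_cst_continuous _ _ (clopen_val N E x z)); rewrite /clopen_val.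
have [h|h] := pselect (in_clopen N E z).
  by apply: filterS (in_clopen_nbhs h) => w hw; rewrite !asboolT.
have /in_clopenC/in_clopen_nbhs := h; apply: filterS => w /in_clopenC hw.
by rewrite !asboolF.
Qed.

Definition clopen_fun N E x : Y := insubd (0 : Y) (clopen_val N E x).

Lemma clopen_funE N E x z :
  cont_fun (clopen_fun N E x) z = if `[< in_clopen N E z >] then x else 0.
Proof. by rewrite /clopen_fun insubd_cont//; exact: clopen_val_continuous. Qed.

Lemma clopen_fun_linear N E : linear (clopen_fun N E).
Proof.
move=> a x y; apply: cont_eq => z; rewrite cont_funD cont_funZ !clopen_funE.
by case: ifP; rewrite // scaler0 addr0.
Qed.

Lemma clopen_funU N E A x : E `&` A = set0 ->
  clopen_fun N (E `|` A) x = clopen_fun N E x + clopen_fun N A x.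
Proof.
move=> EA; apply: cont_eq => z; rewrite cont_funD !clopen_funE.
have [h|h] := pselect (in_clopen N E z).
  rewrite asboolT; last by apply/in_clopenU; left.
  rewrite asboolT// asboolF ?addr0// => h'.
  by apply: (@in_clopen0 N z); rewrite -EA; apply/in_clopenI.
rewrite (asboolF h) add0r; congr (if _ then _ else _); apply: asbool_equiv_eq.
by rewrite in_clopenU; split => [[]|]; [|by []|right].
Qed.

Lemma clopen_fun_trunc N M E x : (N <= M)%N ->
  clopen_fun N E x = clopen_fun M (trunc_pair N @^-1` E) x.
Proof. by move=> NM; apply: cont_eq => z; rewrite !clopen_funE in_clopen_trunc. Qed.

Lemma clopen_fun_agree N E A x : (forall i k, (i <= N.+1)%N -> E (i, k) <-> A (i, k)) ->
  clopen_fun N E x = clopen_fun N A x.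
Proof. by move=> EA; apply: cont_eq => z; rewrite !clopen_funE (in_clopen_agree _ EA). Qed.

Lemma clopen_sumE (I : finType) (c : nat * nat -> I) N (x : I -> X) z i :
  in_clopen N [set p | c p = i] z ->
  cont_fun (\sum_i clopen_fun N [set p | c p = i] (x i)) z = x i.
Proof.
have [j cj ij] := in_clopen_fiber c N z.
move=> /ij ->; rewrite cont_fun_sum (bigD1 j)//= clopen_funE asboolT// big1 ?addr0//.
by move=> k /eqP kj; rewrite clopen_funE asboolF// => /ij.
Qed.

Lemma clopen_sum_norm (I : finType) (c : nat * nat -> I) N (x : I -> X) M : 0 <= M ->
  (forall i, `|x i| <= M) -> `|\sum_i clopen_fun N [set p | c p = i] (x i)| <= M.
Proof.
move=> M0 xM; apply: cont_norm_le => // z.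
by have [i ci _] := in_clopen_fiber c N z; rewrite (clopen_sumE x ci).
Qed.

(** By compactness finitely many clopen sets, on each of which [f] is within [e] of one value, cover
    the space; at a common level a colouring refines them to a partition. *)
Lemma clopen_sum_dense (f : Y) (e : R) N0 : 0 < e ->
  exists N (I : finType) (c : nat * nat -> I) (x : I -> X),
    [/\ (N0 <= N)%N, forall i, `|x i| <= `|f| &
        `|f - \sum_i clopen_fun N [set p | c p = i] (x i)| <= e].
Proof.
move=> e0.
have /choice[NE HNE] : forall z, exists NE, in_clopen NE.1 NE.2 z /\
    in_clopen NE.1 NE.2 `<=` [set w | `|cont_fun f z - cont_fun f w| < e].
  move=> z; have := @cont_fun_continuous _ _ _ f z; move/cvgr_dist_lt => /(_ _ e0).
  by move=> /nbhs_in_clopen[N [E]]; exists (N, E).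
have [z|s sK] := @compact_finite_cover K (fun z => in_clopen (NE z).1 (NE z).2) (@compT K).
  by apply: in_clopen_nbhs; have [] := HNE z.
pose p (i : 'I_(size s)) := tnth (in_tuple s) i.
pose N := maxn N0 (\max_i (NE (p i)).1).
have ND i : ((NE (p i)).1 <= N)%N.
  by rewrite leq_max (@leq_bigmax _ (fun i => (NE (p i)).1) i) orbT.
pose E i := trunc_pair (NE (p i)).1 @^-1` (NE (p i)).2.
(* [None] marks the pairs outside all [E i]; its clopen cell is empty, so the value 0 assigned to it
   is never taken. *)
pose c q := [pick i | `[< E i q >]].
exists N, (option 'I_(size s)), c, (fun i => if i is Some j then cont_fun f (p j) else 0).
split; first exact: leq_maxl.
  by move=> [z|]; rewrite ?normr0//; exact: cont_norm_ge.
apply: cont_norm_le; first exact: ltW.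
move=> w; rewrite cont_funB; have [i ci _] := in_clopen_fiber c N w.
rewrite (clopen_sumE _ ci); case: i ci => [i|] ci; last first.
  exfalso; have [z zs iw] := sK w.
  have /tnthP[i zi] : z \in in_tuple s by []; rewrite {z zs}zi -/(p i) in iw.
  have : in_clopen N (E i `&` [set q | c q = None]) w.
    by apply/in_clopenI; split => //; rewrite /E in_clopen_trunc.
  rewrite (_ : _ `&` _ = set0); first exact: in_clopen0.
  apply/seteqP; split => // q [Eq] /=; rewrite /c; case: pickP => // /(_ i).
  by rewrite asboolT.
have iw : in_clopen N (E i) w.
  have := in_clopenI N (E i) [set q | c q = Some i] w.
  rewrite (_ : _ `&` _ = [set q | c q = Some i]) => [[/(_ ci)[]]//|].
  by apply/setIidPr => q /=; rewrite /c; case: pickP => // j /asboolP Ej [<-].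
rewrite distrC; apply: ltW; apply: (HNE (p i)).2.
by move: iw; rewrite /E in_clopen_trunc.
Qed.
End simple_functions.

(** * Vector measures *)

Lemma variation_coarsen (R : numDomainType) (V : normedZmodType R) (T : Type)
    (nu : set T -> V) (I Q : finType) (c : T -> Q) (g : Q -> I) : fin_additive nu ->
  \sum_i `|nu [set t | g (c t) = i]| <= \sum_q `|nu [set t | c t = q]|.
Proof.
move=> nuD; rewrite [leRHS](partition_big g xpredT)//=; apply: ler_sum => i _.
apply: le_trans (ler_norm_sum _ _ _); rewrite -(fin_additive_fiber nuD c (fun q => g q == i)).
by rewrite (_ : [set t | g (c t) == i] = [set t | g (c t) = i])//; apply/seteqP; split => t /eqP.
Qed.

Lemma dual_fun_additive (R : realType) (X : normedModType R) (T : Type)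
    (nu : set T -> dual X) x : fin_additive nu -> fin_additive (fun A => dual_fun (nu A) x).
Proof. by move=> nuD A B AB; rewrite nuD. Qed.

Section finite_rank.
Context (R : realType) (X : normedModType R) (T : Type) (nu : nat -> set T -> dual X).
Context (s : seq (X * dual X)) (B c : R).
Hypotheses (c0 : 0 < c) (nuD : forall n, fin_additive (nu n)).
Hypothesis nuB : forall n (I : finType) (col : T -> I),
  \sum_i `|nu n [set t | col t = i]| <= B.
Hypothesis nu0 : forall A x, dual_fun (nu n A) x @[n --> \oo] --> 0.
Hypothesis nus : forall n A, rank_op s (nu n A) = nu n A.

(** The norm of a value is at most a weighted sum of its evaluations at the points [y t]. These
    evaluations form one scalar charge on [T * 'I_(size s)], slice by slice, to which
    [setwise_null_signs] applies. *)
Lemma finite_rank_null_signs :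
  exists (r : nat -> nat) (m : nat) (e : {ffun 'I_m -> bool}),
    {homo r : i j / (i < j)%N} /\ forall (I : finType) (col : T -> I),
    \sum_q `|\sum_i (-1) ^+ e i *: nu (r i) [set t | col t = q]| < c * m%:R.
Proof.
pose y t := (tnth (in_tuple s) t).1; pose b t := `|(tnth (in_tuple s) t).2|.
have sE f : rank_op s f = f -> `|f| <= \sum_t b t * `|dual_fun f (y t)|.
  move=> {1}<-; rewrite /rank_op big_tnth; apply: le_trans (ler_norm_sum _ _ _) _.
  by apply: ler_sum => t _; rewrite normrZ mulrC.
pose sl (S : set (T * 'I_(size s))) t := [set p | S (p, t)].
pose sg n S := \sum_t b t * dual_fun (nu n (sl S t)) (y t).
have sgD n : fin_additive (sg n).
  move=> S S' SS'; rewrite /sg -big_split; apply: eq_bigr => t _ /=.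
  rewrite -mulrDr -dual_funD -nuD//.
  by apply/seteqP; split => // p h; rewrite -[set0 p]/(set0 (p, t)) -SS'.
pose B' := \sum_t b t * (B * `|y t|) + 1.
have B0 : 0 <= B by apply: le_trans (nuB 0 (fun=> tt)); rewrite sumr_ge0.
have B'0 : 0 < B'.
  rewrite ltr_wpDl// sumr_ge0// => t _; rewrite mulr_ge0// ?mulr_ge0//; exact: normr_ge0.
have sgB n : tv_le (sg n) setT B'.
  move=> S; rewrite setTI setTD /sg -sumrB; apply: (@le_trans _ _ (\sum_t b t * (B * `|y t|))).
    apply: ler_sum => t _; rewrite -mulrBr ler_wpM2l ?normr_ge0// -dual_funB.
    apply: le_trans (ler_norm _) _; apply: le_trans (dual_fun_le _ _) _.
    rewrite ler_wpM2r//; apply: le_trans (ler_normB _ _) _.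
    apply: le_trans (nuB n (fun p => `[< S (p, t) >])).
    rewrite big_bool /=.
    rewrite (_ : sl S t = [set p | `[< S (p, t) >] = true]); last first.
      by apply/seteqP; split => p /asboolP.
    rewrite (_ : sl (~` S) t = [set p | `[< S (p, t) >] = false])//.
    by apply/seteqP; split => p; [exact: asboolF|move=> h Sp; move: h; rewrite /= asboolT].
  by rewrite lerDl.
have sg0 A : sg n A @[n --> \oo] --> 0.
  rewrite (_ : 0 = \sum_(t < size s) b t * 0); last by rewrite big1// => t _; rewrite mulr0.
  apply: cvg_big => [|t _]; [exact: add_continuous|exact: cvgMr].
have [r [m [e [rS H]]]] := setwise_null_signs B'0 c0 sgD sgB sg0.
exists r, m, e; split => // I col.
pose W A := \sum_(i < m) (-1) ^+ e i *: nu (r i) A.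
have WD : fin_additive W by apply: fin_additive_sum => i; exact: nuD.
have Ws A : rank_op s (W A) = W A.
  by rewrite linear_sum; apply: eq_bigr => i _; rewrite linearZ /= nus.
have WE A x : dual_fun (W A) x = \sum_(i < m) (-1) ^+ e i * dual_fun (nu (r i) A) x.
  by rewrite dual_fun_sum; apply: eq_bigr => i _; rewrite dual_funZ.
(* In slice [t] this takes the colours whose [W] is nonnegative at [y t]; the resulting splitting
   realizes all absolute values at once. *)
pose P t p := 0 <= dual_fun (W [set p' | col p' = col p]) (y t).
apply: le_lt_trans (H [set z | P z.2 z.1]).
apply: (@le_trans _ _ (\sum_q \sum_t b t * `|dual_fun (W [set t | col t = q]) (y t)|)).
  by apply: ler_sum => q _; apply: sE; exact: Ws.
rewrite exchange_big /=.
have -> : \sum_i (-1) ^+ e i * (sg (r i) [set z | P z.2 z.1] - sg (r i) (~` [set z | P z.2 z.1]))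
  = \sum_t b t * (dual_fun (W (sl [set z | P z.2 z.1] t)) (y t) -
      dual_fun (W (sl (~` [set z | P z.2 z.1]) t)) (y t)).
  under eq_bigr do rewrite /sg -sumrB mulr_sumr.
  rewrite exchange_big; apply: eq_bigr => t _ /=.
  rewrite !WE -sumrB mulr_sumr; apply: eq_bigr => i _.
  by rewrite -!mulrBr mulrCA.
apply: ler_sum => t _; rewrite -mulr_sumr ler_wpM2l ?normr_ge0//.
rewrite (fiber_sum_norm col (dual_fun_additive (y t) WD)) /=.
rewrite le_eqVlt; apply/orP; left; apply/eqP; congr (_ - dual_fun (W _) _).
by apply/seteqP; split => p /= /negP.
Qed.
End finite_rank.

Section measures.
Context (R : realType) (X : normedModType R).
Local Notation K := (interval1 nat * beta nat)%type.
Local Notation Y := (cont_space K X).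
Implicit Types (phi : dual Y) (A : set (nat * nat)).

(** The [X^*]-valued finitely additive measure representing [phi] on the clopen
    sets [in_clopen N A]. *)
Definition meas phi N A : dual X :=
  insubd (0 : dual X) (fun x => dual_fun phi (clopen_fun N A x)).

Lemma clopen_fun_norm N A (x : X) : `|clopen_fun N A x| <= `|x|.
Proof.
by apply: cont_norm_le => // z; rewrite clopen_funE; case: ifP => //; rewrite normr0.
Qed.

Lemma measE phi N A x : dual_fun (meas phi N A) x = dual_fun phi (clopen_fun N A x).
Proof.
rewrite /meas (@insubd_dual _ _ _ `|phi|) => [//|a u v|u].
  by rewrite clopen_fun_linear linearP.
apply: le_trans (dual_fun_le _ _) _; rewrite ler_wpM2l//; exact: clopen_fun_norm.
Qed.

Lemma meas_additive phi N : fin_additive (meas phi N).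
Proof.
move=> A B AB; apply: dual_eq => x.
by rewrite dual_funD !measE (clopen_funU _ _ AB) linearD.
Qed.

Lemma meas_trunc phi N M A : (N <= M)%N -> meas phi N A = meas phi M (trunc_pair N @^-1` A).
Proof. by move=> NM; apply: dual_eq => x; rewrite !measE (clopen_fun_trunc _ _ NM). Qed.

Lemma meas_agree phi N A B : (forall i k, (i <= N.+1)%N -> A (i, k) <-> B (i, k)) ->
  meas phi N A = meas phi N B.
Proof. by move=> AB; apply: dual_eq => x; rewrite !measE (clopen_fun_agree _ AB). Qed.

Lemma meas_sum (I : finType) (a : I -> R) (phi : I -> dual Y) N A :
  meas (\sum_i a i *: phi i) N A = \sum_i a i *: meas (phi i) N A.
Proof.
apply: dual_eq => x; rewrite measE !dual_fun_sum; apply: eq_bigr => i _.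
by rewrite !dual_funZ measE.
Qed.

Lemma measB phi psi N A : meas (phi - psi) N A = meas phi N A - meas psi N A.
Proof. by apply: dual_eq => x; rewrite dual_funB !measE. Qed.

(** Nearly norming vectors, one per cell, glue to a simple function in the unit ball. *)
Lemma meas_variation phi N (I : finType) (c : nat * nat -> I) :
  \sum_i `|meas phi N [set p | c p = i]| <= `|phi|.
Proof.
apply/ler_addgt0Pr => e e0; pose h := e / #|I|.+1%:R.
have h0 : 0 < h by rewrite divr_gt0.
have /choice[x Hx] : forall i, exists x, `|x| <= 1 /\
    `|meas phi N [set p | c p = i]| - h < dual_fun (meas phi N [set p | c p = i]) x.
  move=> i; have [|x x1 xh] := @dual_norm_gt _ _ (meas phi N [set p | c p = i])
    (`|meas phi N [set p | c p = i]| - h); first by rewrite ltrBlDr ltrDl.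
  by exists x.
apply: (@le_trans _ _ (\sum_i (dual_fun (meas phi N [set p | c p = i]) (x i) + h))).
  by apply: ler_sum => i _; rewrite -lerBlDr; have [_ /ltW] := Hx i.
rewrite big_split /= sumr_const; apply: lerD; last first.
  rewrite -mulr_natr /h mulrAC ler_pdivrMr// ler_pM2l// ler_nat; exact: leqW.
under eq_bigr do rewrite measE.
rewrite -linear_sum; apply: le_trans (ler_norm _) _; apply: le_trans (dual_fun_le _ _) _.
by rewrite ler_piMr//; apply: clopen_sum_norm => // i; have [] := Hx i.
Qed.

(** Replacing [f] by a simple function costs at most [|phi| * e], so the norm of [phi] is recovered
    from its measures at high levels. *)
Lemma meas_variation_ge phi (f : Y) e N0 : 0 < e -> `|f| <= 1 ->
  exists N (I : finType) (c : nat * nat -> I), (N0 <= N)%N /\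
    dual_fun phi f <= \sum_i `|meas phi N [set p | c p = i]| + `|phi| * e.
Proof.
move=> e0 f1; have [N [I [c [x [N0N xf fx]]]]] := clopen_sum_dense f N0 e0.
exists N, I, c; split => //.
rewrite -[f](subrK (\sum_i clopen_fun N [set p | c p = i] (x i))) linearD /= addrC.
apply: lerD.
  rewrite linear_sum /=; apply: ler_sum => i _; rewrite -measE.
  apply: le_trans (ler_norm _) _; apply: le_trans (dual_fun_le _ _) _.
  by rewrite ler_piMr// (le_trans (xf i)).
apply: le_trans (ler_norm _) _; apply: le_trans (dual_fun_le _ _) _.
by rewrite ler_wpM2l.
Qed.

Lemma meas_cvg (phi : nat -> dual Y) (psi : dual Y) N A x :
  (forall f, dual_fun (phi n) f @[n --> \oo] --> dual_fun psi f) ->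
  dual_fun (meas (phi n) N A) x @[n --> \oo] --> dual_fun (meas psi N A) x.
Proof. by move=> h; rewrite measE; under eq_fun do rewrite measE; exact: h. Qed.

Lemma meas_restr_variation phi N W (I : finType) (c : nat * nat -> I) :
  \sum_i `|meas phi N ([set p | c p = i] `&` W)| <= `|phi|.
Proof.
apply: le_trans (meas_variation phi N (fun p => (c p, `[< W p >]))).
have -> : \sum_q `|meas phi N [set p | (c p, `[< W p >]) = q]| =
    \sum_i \sum_b `|meas phi N [set p | (c p, `[< W p >]) = (i, b)]|.
  by rewrite pair_bigA; apply: eq_bigr => -[].
apply: ler_sum => i _; rewrite big_bool /= ler_wpDr//.
rewrite (_ : _ `&` _ = [set p | (c p, `[< W p >]) = (i, true)])//.
apply/seteqP; split => p /=; first by move=> [-> Wp]; rewrite asboolT.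
by move=> [-> /asboolP].
Qed.

(** The total mass of [phi] plus its mass on the ordinals [< omega]. *)
Definition mass_gt phi (s : R) := exists N (I J : finType) (c : nat * nat -> I) (d : nat * nat -> J),
  s < \sum_i `|meas phi N [set p | c p = i]| +
      \sum_j `|meas phi N ([set p | d p = j] `&` [set p | (p.1 <= N)%N])|.

Lemma mass_gt_bound phi s : mass_gt phi s -> s < 2 * `|phi|.
Proof.
move=> [N [I [J [c [d h]]]]]; apply: lt_le_trans h _; rewrite mulr_natl mulr2n.
by apply: lerD; [exact: meas_variation|exact: meas_restr_variation].
Qed.
End measures.

(** * The gain of mass *)

Section mass_gain.
Context (R : realType) (X : normedModType R).
Local Notation K := (interval1 nat * beta nat)%type.
Local Notation Y := (cont_space K X).

(** The lower l^1 estimate in dual form: testing on such an [f] shows that signed sums of m distinct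
    terms have norm at least [c] times m. *)
Definition interpolates (c : R) (mu : nat -> dual Y) := forall M (t : nat -> R),
  (forall n, `|t n| <= 1) ->
  exists2 f : Y, `|f| <= 1 & forall n, (n < M)%N -> dual_fun (mu n) f = c * t n.

Context (mu : nat -> dual Y) (B c : R) (N n1 : nat).
Hypotheses (B0 : 0 < B) (c0 : 0 < c) (muB : forall n, `|mu n| <= B).
Hypothesis muc : interpolates c mu.

(** Differences over disjoint pairs keep the lower l^1 estimate and are weak-* null when [mu]
    converges weak-*. *)
Let dif i := mu (n1 + i.*2)%N - mu (n1 + i.*2).+1.

Lemma interpolates_signs (r : nat -> nat) m (e : {ffun 'I_m -> bool}) :
  {homo r : i j / (i < j)%N} ->
  exists2 f : Y, `|f| <= 1 & dual_fun (\sum_i (-1) ^+ e i *: dif (r i)) f = c * m%:R.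
Proof.
move=> rS; pose k (i : 'I_m) := (n1 + (r i).*2)%N.
have kI : injective k.
  move=> i j /eqP; rewrite /k eqn_add2l => /eqP/double_inj/(homo_ltn_inj rS)/val_inj.
  exact.
pose t n : R := if [pick i | k i == n] is Some i then (-1) ^+ e i else 0.
have t1 n : `|t n| <= 1.
  by rewrite /t; case: pickP => [i _|_]; rewrite ?normr0// normr_sign.
have tk i : t (k i) = (-1) ^+ e i.
  by rewrite /t; case: pickP => [j /eqP/kI->//|/(_ i)]; rewrite eqxx.
have tkS i : t (k i).+1 = 0.
  by rewrite /t; case: pickP => // j /eqP; rewrite /k; lia.
have [f f1 Hf] := muc (\max_i (k i).+2) t1; exists f => //.
rewrite dual_fun_sum; transitivity (\sum_(i < m) c); last first.
  by rewrite sumr_const card_ord mulr_natr.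
have kM i : ((k i).+1 < \max_i (k i).+2)%N by exact: (leq_bigmax i).
apply: eq_bigr => i _; rewrite dual_funZ dual_funB -/(k i).
rewrite Hf ?(ltn_trans (ltnSn _) (kM i))// Hf// tk tkS mulr0 subr0.
by rewrite mulrCA -expr2 sqrr_sign mulr1.
Qed.

Definition between N N' := [set p : nat * nat | (N < p.1 <= N')%N].

Hypothesis small_tail : forall n N' (I : finType) (col : nat * nat -> I),
  (n1 <= n)%N -> (N <= N')%N ->
  \sum_q `|meas (mu n) N' ([set p | col p = q] `&` between N N')| <= c / 16.

(* With little mass on the ordinals in ]N, omega[, pushing these ordinals forward
   to omega costs little, so the norm of a signed sum is seen at level [N]. *)
Lemma signed_sum_variation (r : nat -> nat) m (e : {ffun 'I_m -> bool}) :
  {homo r : i j / (i < j)%N} -> exists (I : finType) (col : nat * nat -> I),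
  c / 4 * m%:R <= \sum_q `|\sum_i (-1) ^+ e i *: meas (dif (r i)) N [set p | col p = q]|.
Proof.
move=> rS; have [f f1 wf] := interpolates_signs e rS.
set w := \sum_i _ in wf.
(* A bound valid for all late [mu n] passes to [w], a signed sum of [2 * m] of them; it is applied
   to the norm and to the variation on ]N, N']. *)
have wle (nu : dual Y -> R) b : 0 <= b ->
    (forall n, (n1 <= n)%N -> nu (mu n) <= b) ->
    (forall x y, nu (x - y) <= nu x + nu y) ->
    (forall (I : finType) (a : I -> R) (h : I -> dual Y), (forall i, `|a i| = 1) ->
       nu (\sum_i a i *: h i) <= \sum_i nu (h i)) -> nu w <= 2 * m%:R * b.
  move=> b0 nub nuB nuS; apply: le_trans (nuS _ _ _ _) _.
    by move=> i; rewrite normr_sign.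
  rewrite mulrAC mulr_natr -[X in _ *+ X]card_ord -sumr_const; apply: ler_sum => i _.
  apply: le_trans (nuB _ _) _; rewrite mulr_natl mulr2n.
  by apply: lerD; apply: nub; lia.
have wB : `|w| <= 2 * m%:R * B.
  apply: (wle (fun h => `|h|)) => [|n _||I a h a1]; [exact: ltW|exact: muB|exact: ler_normB|].
  apply: le_trans (ler_norm_sum _ _ _) _; apply: ler_sum => i _.
  by rewrite normrZ a1 mul1r.
(* Since [|w|] is at most [2 * m * B], this accuracy costs at most [c / 2 * m]. *)
have c4B : 0 < c / (4 * B) by rewrite divr_gt0// mulr_gt0.
have [N' [I [col [NN' wcol]]]] := meas_variation_ge w N c4B f1.
have wtail (J : finType) (d : nat * nat -> J) :
    \sum_q `|meas w N' ([set p | d p = q] `&` between N N')| <= 2 * m%:R * (c / 16).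
  apply: (wle (fun h => \sum_q `|meas h N' ([set p | d p = q] `&` between N N')|)).
  - by rewrite divr_ge0// ltW.
  - by move=> n n1n; exact: small_tail.
  - move=> x y; rewrite -big_split; apply: ler_sum => q _; rewrite measB.
    exact: ler_normB.
  - move=> I' a h a1; rewrite exchange_big; apply: ler_sum => q _.
    rewrite meas_sum; apply: le_trans (ler_norm_sum _ _ _) _; apply: ler_sum => i _.
    by rewrite normrZ a1 mul1r.
(* [col'] colours all rows beyond [N] as [col] colours the last row [N'.+1]: the ordinals in ]N, N']
   are pushed to the tail. The two measures differ only on these rows. *)
pose d (p : nat * nat) := col (N'.+1, p.2).
pose col' p := if (p.1 <= N)%N then col p else d p.
exists I, col'.
have -> : \sum_q `|\sum_i (-1) ^+ e i *: meas (dif (r i)) N [set p | col' p = q]| =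
    \sum_q `|meas w N [set p | col' p = q]|.
  by apply: eq_bigr => q _; rewrite -meas_sum.
have H q : `|meas w N' [set p | col p = q]| <= `|meas w N [set p | col' p = q]| +
   (`|meas w N' ([set p | col p = q] `&` between N N')| +
    `|meas w N' ([set p | d p = q] `&` between N N')|).
  rewrite (meas_trunc w _ NN').
  have aD := meas_additive w N'.
  set S := trunc_pair N @^-1` _.
  rewrite (fin_additiveID aD [set p | col p = q] (between N N')).
  rewrite (fin_additiveID aD S (between N N')).
  have -> : S `&` between N N' = [set p | d p = q] `&` between N N'.
    apply/seteqP; split => -[i k]; rewrite /S /col' /d /= => -[+ /andP[Ni iN]];
      rewrite (minn_idPr _)// ltnn => dq; by rewrite /between /= Ni iN.
  have -> : meas w N' (S `\` between N N') = meas w N' ([set p | col p = q] `\` between N N').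
    apply: meas_agree => i k iN; rewrite /S /col' /d /between /trunc_pair /=.
    have [iN1|Ni] := leqP i N.
      by rewrite (minn_idPl (leqW iN1)) iN1; split.
    rewrite (minn_idPr Ni) ltnn; have [iN'|N'i] := leqP i N'; first by split => -[_ []].
    by have -> : i = N'.+1 by [lia]; split.
  set x := meas w N' _; set y := meas w N' _; set z := meas w N' _.
  have -> : x + y = (z + y) + (x - z) by rewrite [RHS]addrC addrA subrK.
  by apply: le_trans (ler_normD _ _) _; rewrite lerD2l; exact: ler_normB.
move: wcol; rewrite wf.
have : \sum_q `|meas w N' [set p | col p = q]| <=
    \sum_q (`|meas w N [set p | col' p = q]| +
     (`|meas w N' ([set p | col p = q] `&` between N N')| +
      `|meas w N' ([set p | d p = q] `&` between N N')|)).
  by apply: ler_sum => q _; exact: H.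
rewrite !big_split /=.
have := wtail _ col; have := wtail _ d.
have : `|w| * (c / (4 * B)) <= m%:R * (c / 2).
  apply: le_trans (ler_wpM2r (ltW c4B) wB) _.
  by rewrite le_eqVlt; apply/orP; left; apply/eqP; field; rewrite gt_eqF.
(* Of [c], one half is lost by approximation and one eighth by each of the two tails; one quarter
   remains. *)
have arith (v t a b g M : R) : g <= M * (c / 2) -> a <= 2 * M * (c / 16) ->
    b <= 2 * M * (c / 16) -> v <= t + (b + a) -> c * M <= v + g -> c / 4 * M <= t.
  by lra.
exact: arith.
Qed.
End mass_gain.

Section mass_step.
Context (R : realType) (X : normedModType R) (E : nat -> set (dual X)).
Hypotheses (FE : wstar_FDD E) (mE : monotone_FDD E) (ddE : double_dagger E).
Local Notation K := (interval1 nat * beta nat)%type.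
Local Notation Y := (cont_space K X).
Local Notation P := (FDD_proj E).

Lemma FDD_projD j f g : P j (f + g) = P j f + P j g.
Proof. by have := FDD_proj_linear FE j 1 f g; rewrite !scale1r. Qed.

Lemma FDD_proj0 j : P j 0 = 0.
Proof. by have := FDD_proj_linear FE j (-1) 0 0; rewrite !scaleN1r oppr0 addr0 addNr. Qed.

Lemma FDD_projZ j a f : P j (a *: f) = a *: P j f.
Proof. by have := FDD_proj_linear FE j a f 0; rewrite FDD_proj0 !addr0. Qed.

Lemma FDD_projB j f g : P j (f - g) = P j f - P j g.
Proof. by rewrite FDD_projD -scaleN1r FDD_projZ scaleN1r. Qed.

Lemma double_dagger_sum (C : R) : 0 < C < 1 -> exists2 C', 0 < C' &
  forall (I : finType) (f : I -> dual X) j,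
    \sum_i `|f i - P j (f i)| <= C * \sum_i `|f i| +
      C' * (\sum_i `|f i| - \sum_i `|P j (f i)|).
Proof.
move=> /ddE[C' HC']; exists (Num.max C' 1); first by rewrite lt_max ltr01 orbT.
move=> I f j; rewrite -sumrB !mulr_sumr -big_split; apply: ler_sum => i _ /=.
apply: le_trans (HC' (f i) j) _; rewrite lerD2l ler_wpM2r ?le_max ?lexx//.
by rewrite subr_ge0 FDD_proj_norm.
Qed.

(** [h] is fixed before the functionals, so gains can be iterated. If no [mu n] gained [h], their
    masses on ]N, omega[ would be small past some index, and double-dagger would keep them near the
    range of [P k]; there the weak-* null differences have small signed sums, against
    interpolation. *)
Lemma mass_step (B c : R) : 0 < B -> 0 < c -> exists2 h, 0 < h &
  forall (mu : nat -> dual Y) (phi : dual Y), (forall n, `|mu n| <= B) ->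
    (forall f, dual_fun (mu n) f @[n --> \oo] --> dual_fun phi f) ->
    interpolates c mu -> forall s, mass_gt phi s -> exists n, mass_gt (mu n) (s + h).
Proof.
move=> B0 c0; pose C := Num.min (1 / 2) (c / (64 * B)).
have CB : C * B <= c / 64.
  apply: (@le_trans _ _ (c / (64 * B) * B)).
    by rewrite ler_wpM2r ?(ltW B0)// ge_min lexx orbT.
  by rewrite le_eqVlt; apply/orP; left; apply/eqP; field; rewrite gt_eqF.
have C01 : 0 < C < 1.
  rewrite /C lt_min gt_min; apply/andP; split; last by apply/orP; left; lra.
  by apply/andP; split; [lra|rewrite divr_gt0// mulr_gt0].
have [C' C'0 HC'] := double_dagger_sum C01.
(* The first bound serves a gain on the ordinals below omega, the second a gain from
   double-dagger. *)
pose h := Num.min (c / 16) (c / (64 * C')).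
have h1 : h <= c / 16 by rewrite ge_min lexx.
have h2 : C' * h <= c / 64.
  apply: (@le_trans _ _ (C' * (c / (64 * C')))).
    by rewrite ler_wpM2l ?(ltW C'0)// ge_min lexx orbT.
  by rewrite le_eqVlt; apply/orP; left; apply/eqP; field; rewrite gt_eqF.
(* If the part [a] removed by [P k] exceeds [c / 32], the term [C * m] accounts for at most [c / 64]
   of it, so [C' * (m - Pm)] exceeds [c / 64], hence [C' * h]. *)
have arith (a m Pm Pc t s : R) : c / 32 < a -> a <= C * m + C' * (m - Pm) -> m <= B ->
    Pc <= Pm -> s < Pc + t -> s + h < m + t.
  move=> ca am mB PcPm sPc.
  have CmB : C * m <= C * B by rewrite ler_wpM2l// ltW//; case/andP: C01.
  have : C' * h < C' * (m - Pm) by lra.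
  by rewrite ltr_pM2l//; lra.
have signs_arith (v M : R) : 0 <= M -> c / 4 * M <= v + M * (c / 16) -> c / 8 * M <= v.
  by move=> M0; have : 0 <= M * c by [rewrite mulr_ge0// ltW]; lra.
have c16 : c / 16 = c / 32 + c / 32 by field.
exists h; first by rewrite lt_min divr_gt0//= divr_gt0// mulr_gt0.
move=> mu phi muB mucvg muc s [N [I [J [col [d sF]]]]].
pose F (psi : dual Y) (q : I + J) := match q with
  | inl i => meas psi N [set p | col p = i]
  | inr j => meas psi N ([set p | d p = j] `&` [set p | (p.1 <= N)%N]) end.
pose PF k psi (q : I + J) := if q is inl _ then P k (F psi q) else F psi q.
(* The projections converge weak-* to the identity, so some [P k] keeps the mass above [s]; by
   weak-* continuity of [P k] this persists for late [mu n]. *)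
have [k sk] : exists k, s < \sum_q `|PF k phi q|.
  have : s < \sum_q `|F phi q| by rewrite big_sumType.
  move=> /(@dual_sum_norm_lsc _ _ _ (fun k => PF k phi))[].
    by case=> [i|j] x; [exact: FDD_proj_cvg|exact: cvg_cst].
  by move=> k _ /(_ k (leqnn k)) sk; exists k.
have [n1 _ sn1] : \forall n \near \oo, s < \sum_q `|PF k (mu n) q|.
  apply: dual_sum_norm_lsc sk => -[i|j] x; last exact: meas_cvg.
  by apply: FDD_proj_wstar => // y; exact: meas_cvg.
have {}sn1 n : (n1 <= n)%N -> s < \sum_i `|P k (meas (mu n) N [set p | col p = i])| +
    \sum_j `|meas (mu n) N ([set p | d p = j] `&` [set p | (p.1 <= N)%N])|.
  by move=> /sn1 /=; rewrite big_sumType.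
have Pk_le (psi : dual Y) (Q : finType) (g : nat * nat -> Q) :
    \sum_i `|P k (meas psi N [set p | g p = i])| <= \sum_i `|meas psi N [set p | g p = i]|.
  by apply: ler_sum => i _; exact: FDD_proj_norm.
have PkD (psi : dual Y) : fin_additive (fun A => P k (meas psi N A)).
  by move=> S S' SS'; rewrite (meas_additive psi N SS') FDD_projD.
have [[n [N' [I' [col' [n1n NN' tail]]]]]|no_tail] := pselect (exists n N' (I' : finType)
    (col' : nat * nat -> I'), [/\ (n1 <= n)%N, (N <= N')%N &
    c / 16 < \sum_q `|meas (mu n) N' ([set p | col' p = q] `&` between N N')|]).
  (* Raising the level to [N'] counts the rows ]N, N'] a second time, in the mass below omega; this
     is the gain. *)
  pose d' p : J + I' := if (p.1 <= N)%N then inl (d p) else inr (col' p).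
  exists n, N', I, (J + I')%type, (fun p => col (trunc_pair N p)), d'.
  rewrite big_sumType /=.
  have -> : \sum_i `|meas (mu n) N' [set p | col (trunc_pair N p) = i]| =
      \sum_i `|meas (mu n) N [set p | col p = i]|.
    by apply: eq_bigr => i _; rewrite (meas_trunc _ _ NN').
  have -> : \sum_j `|meas (mu n) N' ([set p | d' p = inl j] `&` [set p | (p.1 <= N')%N])| =
      \sum_j `|meas (mu n) N ([set p | d p = j] `&` [set p | (p.1 <= N)%N])|.
    apply: eq_bigr => j _; rewrite (meas_trunc _ _ NN'); congr (`|meas _ _ _|).
    apply/seteqP; split => -[i l]; rewrite /d' /trunc_pair /=.
      case: (leqP i N) => [iN [[<-]] _|_ []//].
      by rewrite (minn_idPl (leqW iN)).
    rewrite geq_min ltnn orbF => -[+ iN].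
    by rewrite (minn_idPl (leqW iN)) iN => ->; rewrite (leq_trans iN).
  have -> : \sum_j `|meas (mu n) N' ([set p | d' p = inr j] `&` [set p | (p.1 <= N')%N])| =
      \sum_j `|meas (mu n) N' ([set p | col' p = j] `&` between N N')|.
    apply: eq_bigr => j _; congr (`|meas _ _ _|).
    apply/seteqP; split => -[i l]; rewrite /d' /between /=.
      by case: (leqP i N) => [_ []|Ni [[->]] ->].
    by move=> [<- /andP[Ni ->]]; rewrite leqNgt Ni.
  rewrite addrA; apply: ltrD (le_lt_trans h1 tail).
  by apply: lt_le_trans (sn1 n n1n) _; rewrite lerD2r; exact: Pk_le.
have {no_tail}small n N' (I' : finType) (col' : nat * nat -> I') :
    (n1 <= n)%N -> (N <= N')%N ->
    \sum_q `|meas (mu n) N' ([set p | col' p = q] `&` between N N')| <= c / 16.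
  by move=> n1n NN'; rewrite leNgt; apply/negP => lt; apply: no_tail; exists n, N', I', col'.
apply: contrapT => /forallNP no_gain.
have near_P n (Q : finType) (g : nat * nat -> Q) : (n1 <= n)%N ->
    \sum_q `|meas (mu n) N [set p | g p = q] - P k (meas (mu n) N [set p | g p = q])| <= c / 32.
  move=> n1n; rewrite leNgt; apply/negP => gt.
  (* The common refinement sees both the mass kept by [P k] on the cells of [col] and the large
     distance to [P k] on those of [g]. *)
  pose cg p := (col p, g p).
  apply: (no_gain n); exists N, (I * Q)%type, J, cg, d.
  have mD := meas_additive (mu n) N.
  have D2 : fin_additive (fun A => meas (mu n) N A - P k (meas (mu n) N A)).
    by move=> S S' SS'; rewrite (mD _ _ SS') FDD_projD opprD addrACA.
  have H1 := variation_coarsen cg snd D2.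
  have H2 := variation_coarsen cg fst (PkD (mu n)).
  have H3 := HC' _ (fun q => meas (mu n) N [set p | cg p = q]) k.
  have H4 := le_trans (meas_variation (mu n) N cg) (muB n).
  have H5 := sn1 n n1n.
  rewrite /= in H1 H2 H3.
  exact: arith (lt_le_trans gt H1) H3 H4 H2 H5.
have [sq Psq] := FDD_proj_finite FE k.
pose dif i := mu (n1 + i.*2)%N - mu (n1 + i.*2).+1.
(* Signed sums below [c / 8] per term after [P k] will contradict [c / 4] before it, as [P k] moves
   each difference by at most [c / 16]. *)
have [|||||r [m [e [rS Hr]]]] := @finite_rank_null_signs _ _ _
    (fun i A => P k (meas (dif i) N A)) sq (2 * B) (c / 8).
- by rewrite divr_gt0.
- by move=> i; exact: PkD.
- move=> i Q g; apply: le_trans (Pk_le _ _ _) _; apply: le_trans (meas_variation _ _ _) _.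
  by apply: le_trans (ler_normB _ _) _; rewrite mulr_natl mulr2n; apply: lerD.
- move=> A x; rewrite -(dual_fun0 x) -(FDD_proj0 k); apply: FDD_proj_wstar => // y.
  under eq_fun do rewrite /dif measB dual_funB.
  rewrite dual_fun0 -(subrr (dual_fun (meas phi N A) y)).
  have sub (u : nat -> nat) : (forall i, (i <= u i)%N) ->
      dual_fun (meas (mu (u i)) N A) y @[i --> \oo] --> dual_fun (meas phi N A) y.
    move=> iu; apply: (@cvg_comp _ _ _ u (fun n => dual_fun (meas (mu n) N A) y) _ \oo); last exact: meas_cvg.
    by move=> S [M _ HM]; exists M => // i Mi; apply: HM; exact: leq_trans Mi (iu i).
  have le_dbl i : (i <= n1 + i.*2)%N by rewrite -addnn addnA leq_addl.
  by apply: cvgB; apply: sub => i //; exact: leqW.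
- by move=> i A; exact: Psq.
have [Q [g Hg]] := signed_sum_variation B0 c0 muB muc small e rS.
have := Hr Q g; apply/negP; rewrite -leNgt.
have H : \sum_q `|\sum_i (-1) ^+ e i *: meas (dif (r i)) N [set p | g p = q]| <=
   \sum_q `|\sum_i (-1) ^+ e i *: P k (meas (dif (r i)) N [set p | g p = q])| + m%:R * (c / 16).
  apply: (@le_trans _ _ (\sum_q (`|\sum_i (-1) ^+ e i *: P k (meas (dif (r i)) N [set p | g p = q])| +
    \sum_(i < m) `|meas (dif (r i)) N [set p | g p = q] - P k (meas (dif (r i)) N [set p | g p = q])|))).
    apply: ler_sum => q _; rewrite -lerBlDl; apply: le_trans (lerB_dist _ _) _.
    rewrite -sumrB; apply: le_trans (ler_norm_sum _ _ _) _; apply: ler_sum => i _.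
    by rewrite -scalerBr normrZ normr_sign mul1r.
  rewrite big_split lerD2l exchange_big /= mulr_natl -[m in leRHS]card_ord -sumr_const.
  apply: ler_sum => i _.
  have near n := near_P n Q g.
  rewrite c16; apply: le_trans (lerD (near (n1 + (r i).*2)%N (leq_addr _ _))
    (near (n1 + (r i).*2).+1 (leqW (leq_addr _ _)))).
  rewrite -big_split; apply: ler_sum => q _ /=.
  rewrite /dif measB FDD_projB; move: (meas _ _ _) (meas _ _ _) => x y.
  by rewrite opprD addrACA -opprD; exact: ler_normB.
exact: signs_arith (ler0n _ _) (le_trans Hg H).
Qed.
End mass_step.

(** * Functions on [1, omega^omega] *)

Section omega_omega.
Implicit Types f g : omega_omega.

Lemma oo_ltP f g : reflect (exists2 n, (f n < g n)%N & forall m, (n < m)%N -> f m = g m)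
  (f < g)%O.
Proof. exact: asboolP. Qed.

Definition oo_upd f j v : omega_omega := [fsfun f with j |-> v].

Lemma oo_updE f j v i : oo_upd f j v i = if i == j then v else f i.
Proof. exact: fsfun_withE. Qed.

Lemma oo_neq_bot f j : (0 < f j)%N -> f != \bot%O.
Proof. by apply: contraL => /eqP ->; rewrite fsfun0E. Qed.

(** Raising the coefficient of omega^0 by one gives the successor ordinal. *)
Lemma oo_le_lt_succ f g : (g <= f)%O = (g < oo_upd f 0 (f 0%N).+1)%O.
Proof.
rewrite le_eqVlt; apply/orP/oo_ltP => [[/eqP->|/oo_ltP[n gf H]]|[n gf H]].
- by exists 0%N; [rewrite oo_updE eqxx|move=> [|m]//; rewrite oo_updE].
- exists n; first by rewrite oo_updE; case: eqP gf => // -> /ltnW.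
  by move=> [|m]// nm; rewrite oo_updE H.
- case: n gf H => [|n] gf H.
    have {}H m : (0 < m)%N -> g m = f m by case: m => // m /H ->; rewrite oo_updE.
    move: gf; rewrite oo_updE eqxx ltnS leq_eqVlt => /orP[/eqP gf|gf].
      by left; apply/eqP/fsfunP => -[|m]//; exact: H.
    by right; apply/oo_ltP; exists 0%N.
  right; apply/oo_ltP; exists n.+1; first by rewrite oo_updE in gf.
  by move=> [|m]// nm; rewrite H// oo_updE.
Qed.

(** The ordinal 0, not a point of the interval, is sent to omega^omega by default. *)
Definition oo_pt f : interval1 omega_omega :=
  insubd (exist _ (None : upto omega_omega) isT : interval1_ord omega_omega) (Some f).

Lemma val_oo_pt f : f != \bot%O -> val (oo_pt f) = Some f.
Proof. by move=> f0; rewrite /oo_pt val_insubd ifT. Qed.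

(** The set of points at most [f] is clopen, being also the set of points below the successor of
    [f]. *)
Lemma upto_le_nbhs f (x : interval1 omega_omega) : f != \bot%O ->
  \forall y \near x, upto_le (val y) (Some f) = upto_le (val x) (Some f).
Proof.
move=> f0; have [xf|xf] := boolP (upto_le (val x) (Some f)); last first.
  have := interval1_gt_open (oo_pt f); rewrite val_oo_pt// openE => /(_ x xf).
  by apply: filterS => y /negbTE.
pose f1 := oo_upd f 0 (f 0%N).+1.
have f10 : f1 != \bot%O by apply: (@oo_neq_bot _ 0%N); rewrite oo_updE.
have leE (y : upto omega_omega) : upto_le y (Some f) = ~~ upto_le (Some f1) y.
  by case: y => [g|] //=; rewrite -ltNge oo_le_lt_succ.
have := interval1_lt_open (oo_pt f1); rewrite val_oo_pt// openE => /(_ x).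
rewrite /= -leE => /(_ xf); apply: filterS => y /=; rewrite -leE; exact.
Qed.

Section interpolation.
Context (R : realType) (al : nat -> omega_omega).
Hypotheses (al0 : forall n, al n != \bot%O).
Hypothesis alS : {homo al : m n / (m < n)%N >-> (m < n)%O}.

Lemma oo_interpolation M (t : nat -> R) : (forall n, `|t n| <= 1) ->
  exists2 g : cont_space (interval1 omega_omega) R, `|g| <= 1 &
    forall n, (n < M)%N -> cont_fun g (oo_pt (al n)) = t n.
Proof.
move=> t1; pose P (x : interval1 omega_omega) n := upto_le (val x) (Some (al n)).
(* A step function: [t n] on the points up to [al n] and above the earlier [al i], and 0 above all
   of them. *)
pose h x := if [pick n : 'I_M | P x n && [forall i : 'I_M, (i < n)%N ==> ~~ P x i]]
  is Some n then t n else 0.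
have hc : continuous h.
  move=> x; apply: (@near_cst_continuous _ _ (h x)).
  have nP (n : 'I_M) : \forall y \near x, P y n = P x n by exact: upto_le_nbhs.
  have := @filter_forall _ _ (fun (n : 'I_M) y => P y n = P x n) (nbhs x) (nbhs_filter x) nP.
  apply: filterS => y Py; rewrite /h.
  rewrite (@eq_pick _ _ (fun n : 'I_M => P x n && [forall i : 'I_M, (i < n)%N ==> ~~ P x i]))//.
  by move=> n; rewrite /= Py; congr (_ && _); apply: eq_forallb => i; rewrite Py.
exists (insubd (0 : cont_space (interval1 omega_omega) R) h).
  apply: cont_norm_le => // x; rewrite insubd_cont// /h.
  by case: pickP => // _; rewrite normr0.
have alP m n : P (oo_pt (al m)) n = (m <= n)%N.
  rewrite /P val_oo_pt//=; have [/alS|/alS|->] := ltngtP m n; last exact: lexx.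
  - by move/ltW.
  - by rewrite leNgt => ->.
move=> m mM; rewrite insubd_cont// /h; case: pickP => [n|/(_ (Ordinal mM))].
  rewrite alP leq_eqVlt => /andP[/orP[/eqP->//|mn] /forallP/(_ (Ordinal mM))].
  by rewrite alP /= mn leqnn.
rewrite alP leqnn => /forallP; case=> i; apply/implyP => /= im.
by rewrite alP -ltnNge.
Qed.
End interpolation.

(** If the lowest nonzero term of [f] is at [j.+1], this is its fundamental sequence: one
    omega^(j+1) becomes omega^j times n+1. The coefficient at [j] is nonzero, so the terms have
    Cantor-Bendixson rank [j]. *)
Definition oo_approx f j n := oo_upd (oo_upd f j.+1 (f j.+1).-1) j n.+1.

Lemma oo_approxE f j n i : oo_approx f j n i =
  if i == j then n.+1 else if i == j.+1 then (f j.+1).-1 else f i.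
Proof. by rewrite !oo_updE. Qed.

Lemma oo_approx_homo f j : {homo oo_approx f j : m n / (m < n)%N >-> (m < n)%O}.
Proof.
move=> m n mn; apply/oo_ltP; exists j; first by rewrite !oo_approxE eqxx ltnS.
by move=> i ji; rewrite !oo_approxE gtn_eqF.
Qed.

Lemma oo_approx_cvg f j : (0 < f j.+1)%N -> (forall i, (i < j.+1)%N -> f i = 0%N) ->
  oo_pt (oo_approx f j n) @[n --> \oo] --> oo_pt f.
Proof.
move=> fj f0 U /interval1_nbhs[l [r [la ra lrU]]].
have fb := oo_neq_bot fj.
have ab n : oo_approx f j n != \bot%O.
  by apply: (@oo_neq_bot _ j); rewrite oo_approxE eqxx.
have af n : (oo_approx f j n < f)%O.
  apply/oo_ltP; exists j.+1.
    by rewrite oo_approxE eqxx gtn_eqF// ltn_predL.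
  by move=> i ji; rewrite oo_approxE !gtn_eqF// ltnW.
suff [N HN] : exists N, forall n, (N <= n)%N ->
    if l is Some a then ~~ upto_le (val (oo_pt (oo_approx f j n))) (val a) : Prop else True.
  exists N => // n Nn; apply: lrU; first exact: HN.
  case: r ra => // b; rewrite !val_oo_pt//; case: (val b) => //= g.
  by rewrite -!ltNge; exact: lt_trans.
case: l la {lrU} => [a|]; last by exists 0%N.
rewrite val_oo_pt//; case ag: (val a) => [g|]//=; rewrite -ltNge => /oo_ltP[i gf H].
(* The index matters only if [g] agrees with the approximants above [j]; then [g j < n.+1]
   decides. *)
exists (g j) => n gn; rewrite ?ag val_oo_pt//= -ltNge; apply/oo_ltP.
have [ij|ji|ij] := ltngtP i j.+1.
- by move: gf; rewrite f0.
- exists i; first by rewrite oo_approxE !gtn_eqF// ltnW.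
  by move=> m im; have jm := ltn_trans ji im; rewrite oo_approxE !gtn_eqF ?H// ltnW.
- subst i; have [gj|gj] := eqVneq (g j.+1) (f j.+1).-1; last first.
    exists j.+1; first by rewrite oo_approxE eqxx gtn_eqF//; lia.
    by move=> m jm; rewrite oo_approxE !gtn_eqF ?H// ltnW.
  exists j; first by rewrite oo_approxE eqxx ltnS.
  move=> m jm; rewrite oo_approxE gtn_eqF//; case: eqP => [->//|/eqP mj].
  by apply: H; rewrite ltn_neqAle eq_sym mj.
Qed.
End omega_omega.

(** * The quotient map and the climb down from omega^k *)

Section quotient_map.
Local Open Scope quotient_scope.
Context (R : realType) (V : normedModType R) (M : closedSubspace V).

Lemma quotient_pi_linear : linear (\pi_(quotient_space M) : V -> quotient_space M).
Proof.
move=> a v w; rewrite (raddfD \pi_(quotient_space M)); congr (_ + _).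
exact/esym/quotient_pi_scale.
Qed.

Lemma quotient_normE (q : quotient_space M) :
  `|q| = inf [set `|v| | v in [set v | \pi_(quotient_space M) v = q]].
Proof. by []. Qed.

Lemma quotient_pi_norm v : `|\pi_(quotient_space M) v| <= `|v|.
Proof.
rewrite quotient_normE; apply: ge_inf; last by exists v.
by exists 0 => _ [w _ <-].
Qed.

Lemma quotient_lift (q : quotient_space M) b : `|q| < b ->
  exists2 v, \pi_(quotient_space M) v = q & `|v| < b.
Proof.
rewrite quotient_normE => qb.
have [||_ [v vq <-] vb] := @inf_adherent _ [set `|v| | v in [set v | \pi_(quotient_space M) v = q]]
    (b - `|q|).
- by rewrite subr_gt0.
- split; first by exists `|repr q|, (repr q) => //=; rewrite reprK.
  by exists 0 => _ [w _ <-].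
- by exists v => //; move: vb; rewrite -quotient_normE addrC subrK.
Qed.
End quotient_map.

Theorem theorem4p3 (R : realType) (X : completeNormedModType R) :
  satisfies_daggers X ->
  ~ exists M : closedSubspace (cont_space (interval1 nat * beta nat)%type X),
      isomorphic (cont_space (interval1 omega_omega) R) (quotient_space M).
Proof.
move=> [E [FE mE ddE]] [M [T [S [lT cT cS TK SK]]]].
have lS : linear S by move=> a p q; apply: (can_inj TK); rewrite lT !SK.
have [A A0 TA] := linear_bounded lT cT.
have [B B0 SB] := linear_bounded lS cS.
pose Y := cont_space (interval1 nat * beta nat)%type X.
pose pi : Y -> quotient_space M := \pi_(quotient_space M)%qT.
(* The operator onto C([1, omega^omega]) is [S \o pi]; [phi x] follows it by evaluation at [x]. *)
pose phi x : dual Y := insubd (0 : dual Y) (fun f => cont_fun (S (pi f)) x).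
have phiB x f : `|cont_fun (S (pi f)) x| <= B * `|f|.
  apply: le_trans (cont_norm_ge _ _) _; apply: le_trans (SB _) _.
  by rewrite ler_pM2l//; exact: quotient_pi_norm.
have phiE x f : dual_fun (phi x) f = cont_fun (S (pi f)) x.
  rewrite /phi (insubd_dual _ (phiB x))// => a u v.
  by rewrite /pi quotient_pi_linear lS.
have phi_norm x : `|phi x| <= B.
  apply: dual_norm_le => f f1; rewrite phiE; apply: le_trans (ler_norm _) _.
  by apply: le_trans (phiB _ _) _; rewrite ler_piMr// ltW.
(* [T g] lifts to a function of norm below [A + 1], which [c] scales into the unit ball. *)
pose c := (A + 1)^-1; have A1 : 0 < A + 1 by rewrite addr_gt0.
have c0 : 0 < c by rewrite invr_gt0.
have [h h0 gain] := mass_step FE mE ddE B0 c0.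
have phi_interp al : (forall n, al n != \bot%O) ->
    {homo al : m n / (m < n)%N >-> (m < n)%O} -> interpolates c (fun n => phi (oo_pt (al n))).
  move=> al0 alS m t t1; have [g g1 gt] := oo_interpolation al0 alS m t1.
  have [|f fg fA] := @quotient_lift _ _ M (T g) (A + 1).
    by apply: le_lt_trans (TA g) _; rewrite (le_lt_trans (ler_piMr _ g1)) ?ltrDl// ltW.
  exists (c *: f).
    by rewrite normrZ gtr0_norm// /c mulrC ler_pdivrMr// mul1r ltW.
  move=> n nm; rewrite phiE /pi; have := quotient_pi_linear M c f 0.
  rewrite addr0 (raddf0 \pi_(quotient_space M)%qT) addr0 => ->; rewrite fg.
  have := lS c (T g) 0; rewrite addr0.
  have -> : S 0 = 0 by have := lS (-1) 0 0; rewrite !scaleN1r oppr0 addr0 addNr.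
  by rewrite addr0 => ->; rewrite TK cont_funZ gt.
(* Induction on the Cantor-Bendixson rank [j] of [f]: the fundamental sequence has rank one less and
   some term of it gains [h]. *)
have climb j : forall (f : omega_omega) s, (0 < f j)%N -> (forall i, (i < j)%N -> f i = 0%N) ->
    mass_gt (phi (oo_pt f)) s -> exists g, mass_gt (phi (oo_pt g)) (s + h *+ j).
  elim: j => [|j IH] f s fj f0 fs; first by exists f; rewrite mulr0n addr0.
  have ab n : oo_approx f j n != \bot%O.
    by apply: (@oo_neq_bot _ j); rewrite oo_approxE eqxx.
  have [|n] := gain (fun n => phi (oo_pt (oo_approx f j n))) (phi (oo_pt f))
    (fun n => phi_norm _) _ (phi_interp _ ab (@oo_approx_homo f j)) s fs.
    move=> u; rewrite phiE; under eq_fun do rewrite phiE.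
    by apply: (cvg_comp _ _ (oo_approx_cvg fj f0)); exact: cont_fun_continuous.
  move=> /IH[||g].
  - by rewrite oo_approxE eqxx.
  - by move=> i ij; rewrite oo_approxE !ltn_eqF ?f0// ltnW.
  - by exists g; rewrite mulrS addrA.
(* Masses are at most [2 * B]. The climb starts at omega^k from the bound -1, which the strict
   [mass_gt] admits even for zero mass; hence the extra 1. *)
pose k := (Num.truncn ((2 * B + 1) / h)).+1.
have kh : 2 * B + 1 < h *+ k.
  by rewrite -[h *+ k]mulr_natl -ltr_pdivrMr// /k truncnS_gt.
pose f := oo_upd [fsfun] k 1.
have [|||g /mass_gt_bound] := climb k f (-1).
- by rewrite oo_updE eqxx.
- by move=> i ik; rewrite oo_updE ltn_eqF// fsfun0E.
- exists 0%N, unit, unit, (fun=> tt), (fun=> tt).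
  by rewrite (@lt_le_trans _ _ 0)// ?ltrN10// addr_ge0// sumr_ge0.
- have := phi_norm (oo_pt g); lra.
Qed.
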